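(* Let $\sigma\in\{0,1\}$ and let $N,\ell,M,L_1+\frac{\ell+\sigma}{2},L_2+\frac{\ell+\sigma}{2}$ be integers such that $\ell+\sigma N$ is even, $N\ge 1$ and $L_1,L_2\ge 0$. Then $$ \sum_{i=0}^M q^{i(i+\ell)/N}\genfrac{[}{]}{0pt}{}{L_1+L_2+M-i}{M-i} \sum_{\substack{n\in\mathbb{Z}^{N-1}\\ \frac{2i+\ell+\sigma N}{2N}+(C^{-1}n)_1\in\mathbb{Z}}} q^{nC^{-1}n}\genfrac{[}{]}{0pt}{}{m+n}{n} \genfrac{[}{]}{0pt}{}{L_1+\frac12 m_1}{i+\ell}\genfrac{[}{]}{0pt}{}{L_2+\frac12 m_1}{i} $$ $$ =\sum_{\substack{\eta\in\mathbb{Z}^{N-1}\\ \frac{\ell+\sigma N}{2N}+(C^{-1}\eta)_1\in\mathbb{Z}}} q^{\eta C^{-1}\eta}\genfrac{[}{]}{0pt}{}{\mu+\eta}{\eta} \genfrac{[}{]}{0pt}{}{L_1+\frac12(M+\mu_1)}{M+\ell} \genfrac{[}{]}{0pt}{}{L_2+\frac12(M+\ell+\mu_{N-1})}{M}, $$ where on the left-hand side the vector $m\in\mathbb{Z}^{N-1}$ is determined by $n$ and $i$ through $$m+n=\tfrac12\bigl(\mathcal{I}m+(2i+\ell)e_1\bigr),$$ and on the right-hand side the vector $\mu\in\mathbb{Z}^{N-1}$ is determined by $\eta$ through $$\mu+\eta=\tfrac12\bigl(\mathcal{I}\mu+(M+\ell)e_1+Me_{N-1}\bigr).$$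
   Context: $(q)_k=\prod_{j=1}^k(1-q^j)$ for $k\ge 0$. The $q$-binomial coefficient is $$\genfrac{[}{]}{0pt}{}{a+b}{a}=\frac{(q)_{a+b}}{(q)_a(q)_b}\ \text{ if } a,b\ge 0 \text{ are integers, and } 0 \text{ otherwise.}$$ In particular $\genfrac{[}{]}{0pt}{}{t}{k}=0$ unless $0\le k\le t$. $C$ is the Cartan matrix of $A_{N-1}$: $C_{ij}=2\delta_{i,j}-\delta_{|i-j|,1}$ for $i,j=1,\dots,N-1$. $\mathcal{I}=2I-C$ is the incidence matrix ($I$ the identity matrix). $e_1,\dots,e_{N-1}$ are the standard unit vectors of $\mathbb{Z}^{N-1}$. Notation: $nC^{-1}n=\sum_{i,j=1}^{N-1}n_iC^{-1}_{ij}n_j$, and $(C^{-1}n)_1=\sum_{j}C^{-1}_{1j}n_j$. For vectors, $\genfrac{[}{]}{0pt}{}{m+n}{n}=\prod_{j=1}^{N-1}\genfrac{[}{]}{0pt}{}{m_j+n_j}{n_j}$, and similarly for $\genfrac{[}{]}{0pt}{}{\mu+\eta}{\eta}$. The linear equations are equivalent to $m=C^{-1}((2i+\ell)e_1-2n)$ and $\mu=C^{-1}((M+\ell)e_1+Me_{N-1}-2\eta)$; the restrictions on the sums over $n$ and $\eta$ ensure that $m$ and $\mu$ have integer components of the parity making all entries of the $q$-binomials integers. Convention for $N=1$: the sums over $n$ and $\eta$ (and the factors $q^{nC^{-1}n}\genfrac{[}{]}{0pt}{}{m+n}{n}$, $q^{\eta C^{-1}\eta}\genfrac{[}{]}{0pt}{}{\mu+\eta}{\eta}$)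 drop out, $m_1=0$ on the left-hand side, and on the right-hand side $\mu_1$ is read as $M$ and $\mu_{N-1}=\mu_0$ as $M+\ell$. A sum $\sum_{i=0}^M$ with $M<0$ is zero. Fractional powers of $q$ are formal (or use a fixed consistent choice of roots, $|q|<1$). *)

(* Defs.v *)
From mathcomp Require Import all_boot all_order all_algebra.
From mathcomp Require Import boolp classical_sets cardinality fsbigop.
From mathcomp Require Import ring lra.

Set Implicit Arguments.
Unset Strict Implicit.
Unset Printing Implicit Defensive.
Import Order.TTheory GRing.Theory Num.Theory.

Local Open Scope classical_set_scope.
Local Open Scope ring_scope.

(* A consistent choice of the rational powers of [q]; [pw 0 = 1] forces
   [q != 0].  Instances: [q] formal, in the fraction field of the group algebra
   of the rationals; or a nonzero complex number with a choice of logarithm. *)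
Definition rat_powers (F : fieldType) (q : F) (pw : rat -> F) : Prop :=
  [/\ pw 1 = q, pw 0 = 1 & {morph pw : a b / a + b >-> a * b}].

Definition qfact (F : fieldType) (q : F) (k : nat) : F :=
  \prod_(1 <= j < k.+1) (1 - q ^+ j).

(* [qbin q t k] has top entry [t] and bottom entry [k].  The entries are
   rational, because they are half-integers a priori; the value is 0 unless
   both [k] and [t - k] are nonnegative integers. *)
Definition qbin (F : fieldType) (q : F) (t k : rat) : F :=
  if (k \is a Num.nat) && (t - k \is a Num.nat)
  then qfact q (Num.truncn t)
       / (qfact q (Num.truncn k) * qfact q (Num.truncn (t - k)))
  else 0.

Definition qbinv (F : fieldType) (q : F) (r : nat) (t k : 'cV[int]_r) : F :=
  \prod_(j < r) qbin q (t j 0)%:~R (k j 0)%:~R.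

Definition cartanA (r : nat) : 'M[rat]_r :=
  \matrix_(i, j) (2 * (i == j)%:R - ((i.+1 == j :> nat) || (j.+1 == i :> nat))%:R).

Definition incidenceA (r : nat) : 'M[rat]_r := 2%:M - cartanA r.

Definition ratv (r : nat) (v : 'cV[int]_r) : 'cV[rat]_r := map_mx intr v.

Definition qformA (r : nat) (v : 'cV[int]_r) : rat :=
  ((ratv v)^T *m invmx (cartanA r) *m ratv v) 0 0.

(* Components and unit vectors are numbered from 1.  The default [d] is the
   value of the component when [k] is out of range, which is how the case of
   empty vectors ([r = 0]) is handled. *)
Definition entry (T : Type) (r : nat) (d : T) (v : 'cV[T]_r) (k : nat) : T :=
  if [pick j : 'I_r | j.+1 == k] is Some j then v j 0 else d.

Definition unitv (r k : nat) : 'cV[int]_r := \col_j (j.+1 == k)%:R.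

Definition mn_system (r : nat) (b n m : 'cV[int]_r) : Prop :=
  ratv (m + n) = 2^-1 *: (incidenceA r *m ratv m + ratv b).

(* The integral solution [m] of the linear system.  It is unique when it exists
   ([mn_system_uniq]); the default 0 is never used in the sums considered
   ([lhs_solution], [rhs_solution]). *)
Definition mn_solve (r : nat) (b n : 'cV[int]_r) : 'cV[int]_r :=
  xget 0 [set m | mn_system b n m].

Definition mvec (r : nat) (l i : int) (n : 'cV[int]_r) : 'cV[int]_r :=
  mn_solve ((2 * i + l) *: unitv r 1) n.

Definition muvec (r : nat) (l M : int) (eta : 'cV[int]_r) : 'cV[int]_r :=
  mn_solve ((M + l) *: unitv r 1 + M *: unitv r r) eta.

(* The sums over the vectors satisfying this condition have finite support:
   [qbinv q (m + n) n] is 0 unless [n] and [m] have nonnegative entries, and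
   then [m_1 >= 0] bounds [n], since [C^-1] has positive entries. *)
Definition parity_cond (N : nat) (sigma a : int) (n : 'cV[int]_N.-1) : Prop :=
  (a + sigma * N%:Z)%:~R / (2 * N%:R)
    + entry 0 (invmx (cartanA N.-1) *m ratv n) 1 \is a Num.int.

Definition greenA (r : nat) : 'M[rat]_r :=
  \matrix_(i, j) ((minn i.+1 j.+1)%:R - (i.+1 * j.+1)%:R / r.+1%:R).

Lemma sum_delta (r c : nat) (g : nat -> rat) :
  \sum_(k < r) (k == c :> nat)%:R * g k = (c < r)%N%:R * g c.
Proof.
have [cr|cr] := ltnP c r; last first.
  rewrite mul0r big1 // => k _; case: eqP => [kc|]; last by rewrite mul0r.
  by have := ltn_ord k; rewrite kc ltnNge cr.
rewrite (bigD1 (Ordinal cr)) //= eqxx big1 ?addr0 // => k.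
by rewrite -val_eqE /= => /negPf ->; rewrite mul0r.
Qed.

Lemma cartanA_sum (r : nat) (i : 'I_r) (f : nat -> rat) :
  \sum_(k < r) cartanA r i k * f k.+1 =
  2 * f i.+1 - f i - f i.+2
  + (i == 0 :> nat)%:R * f 0 + (i.+1 == r)%:R * f r.+1.
Proof.
under eq_bigr => k _.
  have -> : cartanA r i k * f k.+1 =
    2 * ((k == i :> nat)%:R * f k.+1) - (k == i.+1 :> nat)%:R * f k.+1
    - (k.+1 == i)%:R * f k.+1.
    rewrite mxE -val_eqE /= [nat_of_ord i == k]eq_sym [i.+1 == k]eq_sym.
    have -> : ((k == i.+1 :> nat) || (k.+1 == i))%:R
            = (k == i.+1 :> nat)%:R + (k.+1 == i)%:R :> rat.
      by case: eqP => [->|_] /=; [rewrite -[i.+2]addn2 -[X in _ == X]addn0 eqn_add2l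
                                 | rewrite add0r].
    by ring.
  over.
rewrite !sumrB -mulr_sumr (sum_delta r i (fun k => f k.+1)) ltn_ord mul1r.
rewrite (sum_delta r i.+1 (fun k => f k.+1)).
have -> : \sum_(k < r) (k.+1 == i)%:R * f k.+1 = f i - (i == 0 :> nat)%:R * f 0.
  case: i => [[|i] /= ir].
    by rewrite mul1r subrr big1 // => k _; rewrite mul0r.
  under eq_bigr do rewrite eqSS.
  by rewrite (sum_delta r i (fun k => f k.+1)) (ltnW ir) mul1r mul0r subr0.
have [ir|ir] := eqVneq i.+1 r.
  by rewrite ir ltnn /=; ring.
by rewrite ltn_neqAle ir ltn_ord /=; ring.
Qed.

Lemma minn_diff2 (i a : nat) :
  2 * (minn i.+1 a)%:R - (minn i a)%:R - (minn i.+2 a)%:R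
  = (i.+1 == a)%:R :> rat.
Proof.
have [ia|ia|ia] := ltngtP i.+1 a.
- rewrite (minn_idPl (ltnW (ltnW ia))) (minn_idPl ia).
  by rewrite /=; ring.
- rewrite !(minn_idPr _) //=; first ring.
  exact: leqW (ltnW ia).
- rewrite -ia (minn_idPl (leqnSn i)) (minn_idPr (leqnSn _)).
  by rewrite /=; ring.
Qed.

Lemma cartanA_green (r : nat) : cartanA r *m greenA r = 1%:M.
Proof.
apply/matrixP => i j; rewrite mxE.
pose f k : rat := (minn k j.+1)%:R - (k * j.+1)%:R / r.+1%:R.
under eq_bigr => k _.
  have -> : greenA r k j = f k.+1 by rewrite mxE.
  over.
rewrite cartanA_sum.
have r0 : r.+1%:R != 0 :> rat by rewrite pnatr_eq0.
have -> : f 0 = 0 by rewrite /f min0n mul0n mul0r subrr.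
have -> : f r.+1 = 0.
  by rewrite /f (minn_idPr _) 1?ltnW ?ltnS // natrM mulrAC mulfV // mul1r subrr.
rewrite !mulr0 !addr0 !mxE -val_eqE /=.
rewrite -[i == j :> nat]eqSS -minn_diff2 /f !natrM -!natr1; ring.
Qed.

Lemma cartanA_unit (r : nat) : cartanA r \in unitmx.
Proof. by case: (mulmx1_unit (cartanA_green r)). Qed.

Lemma invmx_cartanA (r : nat) : invmx (cartanA r) = greenA r.
Proof.
by rewrite -[RHS](mulKmx (cartanA_unit r)) cartanA_green mulmx1.
Qed.

Lemma ratv_inj (r : nat) : injective (@ratv r).
Proof.
move=> u v /matrixP uv; apply/matrixP => i j.
by move: (uv i j); rewrite !mxE => /intr_inj.
Qed.

Lemma mn_systemC (r : nat) (b n m : 'cV[int]_r) :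
  mn_system b n m <-> cartanA r *m ratv m = ratv b - 2 *: ratv n.
Proof.
rewrite /mn_system /incidenceA /ratv map_mxD /= mulmxBl mul_scalar_mx.
set cm := _ *m _; set m' := map_mx _ m; set n' := map_mx _ n.
set b' := map_mx _ b.
split => /matrixP h; apply/matrixP => i j; move: (h i j); rewrite !mxE; lra.
Qed.

Lemma mn_systemP (r : nat) (b n m : 'cV[int]_r) :
  mn_system b n m <->
  ratv m = invmx (cartanA r) *m (ratv b - 2 *: ratv n).
Proof.
rewrite mn_systemC; split => [<-|->].
  by rewrite mulKmx ?cartanA_unit.
by rewrite mulKVmx ?cartanA_unit.
Qed.

Lemma mn_system_uniq (r : nat) (b n m m' : 'cV[int]_r) :
  mn_system b n m -> mn_system b n m' -> m = m'.
Proof. by move=> /mn_systemP h /mn_systemP h'; apply: ratv_inj; rewrite h. Qed.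

Lemma mn_solveP (r : nat) (b n : 'cV[int]_r) :
  (exists m, mn_system b n m) -> mn_system b n (mn_solve b n).
Proof. by move=> ex; apply: (@xgetPex _ 0 [set m | mn_system b n m]). Qed.

Lemma mn_solution (N : nat) (sigma A B : int) (n : 'cV[int]_N.-1) :
  parity_cond sigma (A - B) n ->
  exists m, mn_system (A *: unitv N.-1 1 + B *: unitv N.-1 N.-1) n m.
Proof.
case: N n => [|[|r]] n /=; rewrite /parity_cond /=.
- by exists 0; apply/matrixP => -[].
- by exists 0; apply/matrixP => -[].
have -> : entry 0 (invmx (cartanA r.+1) *m ratv n) 1
        = (invmx (cartanA r.+1) *m ratv n) 0 0.
  by rewrite /entry; case: pickP => [j /eqP [j0]|/(_ ord0)] //; congr (_ _ _);
    apply: val_inj.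
rewrite invmx_cartanA mxE => /intrP [t ht].
pose S : rat := \sum_(k < r.+1) k.+1%:R * (n k 0)%:~R.
pose T : int := \sum_(k < r.+1) n k 0.
pose w : int := sigma + 2 * T - 2 * t.
have r0 : r.+2%:R != 0 :> rat by rewrite pnatr_eq0.
have hsum : \sum_(j < r.+1) greenA r.+1 0 j * ratv n j 0 = T%:~R - S / r.+2%:R.
  rewrite /T /S rmorph_sum /= mulr_suml -sumrB; apply: eq_bigr => k _.
  by rewrite !mxE (minn_idPl _) //= mul1n; ring.
have hw : w%:~R * r.+2%:R = 2 * S - (A - B)%:~R.
  rewrite /w; move: ht; rewrite hsum => ht.
  have -> : S = r.+2%:R * (S / r.+2%:R) by rewrite mulrC mulfVK.
  have -> : S / r.+2%:R = (A - B + sigma * r.+2)%:~R / (2 * r.+2%:R) + T%:~R - t%:~R.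
    by rewrite -ht; ring.
  rewrite !(rmorphB, rmorphD, rmorphM) /=.
  have -> : (r.+2 : int)%:~R = r.+2%:R :> rat by [].
  by field; move: r0; rewrite -[r.+2]addn2 natrD addrC.
pose fI (k : nat) : int :=
  A - 2 * (\sum_(j < r.+1) (minn k j.+1)%:Z * n j 0) + k%:Z * w.
exists (\col_j fI j.+1); apply/mn_systemC; apply/matrixP => i j.
rewrite {j}(ord1 j) mxE.
pose f k : rat := (fI k)%:~R.
under eq_bigr => k _.
  have -> : ratv (\col_j fI j.+1) k 0 = f k.+1 by rewrite !mxE.
  over.
rewrite cartanA_sum.
pose g (k : nat) : rat := \sum_(j < r.+1) (minn k j.+1)%:R * (n j 0)%:~R.
have fE k : f k = A%:~R - 2 * g k + k%:R * w%:~R.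
  rewrite /f /fI !(rmorphB, rmorphD, rmorphM) /= /g rmorph_sum /=.
  by congr (_ - _ * _ + _); apply: eq_bigr => j _; rewrite rmorphM.
have g0 : g 0 = 0 by rewrite /g big1 // => j _; rewrite min0n mul0r.
have gS : g r.+2 = S.
  apply: eq_bigr => j _; rewrite (minn_idPr _) //.
  by rewrite ltnS; apply: ltnW.
have g2 : 2 * g i.+1 - g i - g i.+2 = (n i 0)%:~R.
  rewrite /g mulr_sumr -!sumrB.
  under eq_bigr => j _ do rewrite mulrA -!mulrBl minn_diff2 eqSS.
  rewrite (bigD1 i) //= eqxx mul1r big1 ?addr0 // => j.
  by rewrite eq_sym -val_eqE => /negPf -> ; rewrite mul0r.
have f0 : f 0 = A%:~R by rewrite fE g0; ring.
have fr : f r.+2 = B%:~R.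
  by rewrite fE gS mulrC mulrC [_ * w%:~R]mulrC hw rmorphB /=; ring.
rewrite f0 fr !fE !mxE -g2 !eqSS eq_sym /=.
rewrite !(rmorphD, rmorphM) /= -!natr1.
have e (c : bool) : (c%:R : int)%:~R = c%:R :> rat by case: c.
rewrite !e; ring.
Qed.

Lemma lhs_solution (N : nat) (sigma l i : int) (n : 'cV[int]_N.-1) :
  parity_cond sigma (2 * i + l) n ->
  mn_system ((2 * i + l) *: unitv N.-1 1) n (mvec l i n).
Proof.
move=> h; apply: mn_solveP.
rewrite -[_ *: _]addr0 -(scale0r (unitv N.-1 N.-1)).
by apply: (mn_solution (sigma := sigma)); rewrite subr0.
Qed.

Lemma rhs_solution (N : nat) (sigma l M : int) (eta : 'cV[int]_N.-1) :
  parity_cond sigma l eta ->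
  mn_system ((M + l) *: unitv N.-1 1 + M *: unitv N.-1 N.-1) eta
    (muvec l M eta).
Proof.
move=> h; apply: mn_solveP; apply: (mn_solution (sigma := sigma)).
by rewrite addrC addKr.
Qed.

(* Main.v *)
Require Import Defs.
From mathcomp Require Import all_boot all_order all_algebra.
From mathcomp Require Import boolp classical_sets cardinality fsbigop.
From mathcomp Require Import ring lra zify.

Set Implicit Arguments.
Unset Strict Implicit.
Unset Printing Implicit Defensive.

Import Order.TTheory GRing.Theory Num.Theory.

Local Open Scope classical_set_scope.
Local Open Scope ring_scope.

(** Completing the square in [n C^-1 n] gives the same kind of sum on both sides.
Put [m_0 = 2 i + l], [m_N = 0] on the left and [mu_0 = M + l], [mu_N = M] on the
right.  The linear system says [m_j + n_j = (m_(j-1) + m_(j+1)) / 2], and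

    n C^-1 n = 1/4 (sum_(0 <= j < N) (m_j - m_(j+1))^2 - (m_0 - m_N)^2 / N).

So each side is [q^(- l^2 / 4N)] times a sum over chains of heights
[m_0, ..., m_N], with a Gaussian weight on every edge and the q-binomial of top
[(m_(j-1) + m_(j+1)) / 2] and bottom [m_j] on every inner node.  On the right
([cycle_sum], [rhs_cycle_sum]) the end nodes [A = M + l] and [B = M] carry
q-binomials as well, and each end is a neighbour of the other, as in a closed
cycle.  On the left ([fork_sum], [lhs_fork]) the chain goes down to 0, its first
node is forked into [a = i + l] and [b = i], and the sum over [i] runs over
[a = A - k], [b = B - k] with the weight of top [L1 + L2 + k] and bottom [k].

The two sums are equal because they obey the same linear relations.  Functions
of two consecutive heights are acted on by two operators [opA] and [opB], of
three shift terms each, that commute with prolonging the chain by one node; this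
is q-Pascal, in its two forms.  At an end of the chain they become three-term
combinations of shifts of the end height and of its inhomogeneity.  Pushing
them from one end of the chain to the other thus gives two relations between
shifts of [(A, L1)] and shifts of [(B, L2)] ([cycle_sum_relA],
[cycle_sum_relB]).  For the forked sum the same two relations hold term by term
([fork_sum_relations]).

Let [D] be the difference of the two sums, and suppose that it vanishes for
bottom entries [B] and [B - 1].  The relations then say that the values of
[D] at [B + 1] and two values of [L2] that differ by 1 satisfy [D' = q^(B+1) D]
and [D' = D], so [D = 0] ([cycle_fork_sum]).  For [B = 0] both sums are the same
chain down to 0 ([cycle_fork_sum0]).

For [N = 1] this proves the q-Saalschutz sum.  As [L1] and [L2] tend to infinity
the relation from [opA] becomes the recurrence of the continuous q-Hermite
polynomials, and the identity becomes their linearization formula, evaluated by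
a linear functional. *)

Section GeneralizedSaalschutz.

Variables (F : fieldType) (q : F) (pw : rat -> F).
Hypothesis hpw : rat_powers q pw.
Hypothesis hq : forall k : nat, (0 < k)%N -> q ^+ k != 1.

(** * Powers of q and q-binomial coefficients *)

Lemma pwD a b : pw (a + b) = pw a * pw b.
Proof. by case: hpw. Qed.

Lemma pw0 : pw 0 = 1.
Proof. by case: hpw. Qed.

Lemma pw_neq0 a : pw a != 0.
Proof.
have h : pw a * pw (- a) = 1 by rewrite -pwD subrr pw0.
by apply: contra_eq_neq h => ->; rewrite mul0r eq_sym oner_eq0.
Qed.

Lemma pw_nat n : pw n%:R = q ^+ n.
Proof.
elim: n => [|n IHn]; first by rewrite pw0.
by rewrite -addn1 natrD pwD IHn exprD; case: hpw => ->.
Qed.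

Lemma pw_sum r (c : nat -> rat) : pw (\sum_(j < r) c j) = \prod_(j < r) pw (c j).
Proof.
elim: r => [|r IHr]; first by rewrite !big_ord0 pw0.
by rewrite !big_ord_recr pwD IHr.
Qed.

Lemma qfactS n : qfact q n.+1 = qfact q n * (1 - q ^+ n.+1).
Proof. by rewrite /qfact big_nat_recr. Qed.

Lemma qfact_neq0 n : qfact q n != 0.
Proof.
elim: n => [|n IHn]; first by rewrite /qfact big_geq ?oner_eq0.
by rewrite qfactS mulf_neq0 // subr_eq0 eq_sym hq.
Qed.

Lemma qbin_nat (n k : nat) :
  qbin q n%:R k%:R =
  if (k <= n)%N then qfact q n / (qfact q k * qfact q (n - k)) else 0.
Proof.
rewrite /qbin natr_nat /=; case: leqP => kn.
  by rewrite -natrB // natr_nat !natrK.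
case: ifP => // /natr_ge0; rewrite subr_ge0 ler_nat leqNgt kn //.
Qed.

Lemma qbin_sym t k : qbin q t k = qbin q t (t - k).
Proof. by rewrite /qbin subKr andbC [_ * qfact q _]mulrC. Qed.

(** The bottom entries that occur are integers, whereas the top entries are
half-integers a priori and the coefficient is zero at the wrong parity. *)
Definition qb (x : rat) (k : int) : F := qbin q x k%:~R.

Lemma qb_neq0 x k : qb x k != 0 ->
  [/\ 0 <= k, k%:~R <= x & x \is a Num.int].
Proof.
rewrite /qb /qbin; case: ifP => [/andP[hk hx] _|_]; last by rewrite eqxx.
split; first by have := natr_ge0 hk; rewrite ler0z.
  by have := natr_ge0 hx; rewrite subr_ge0.
by rewrite -[x](subrK k%:~R) rpredD ?intr_int // intr_nat.
Qed.

Lemma qb_lt0 x k : k < 0 -> qb x k = 0.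
Proof. by move=> k0; apply/eqP; apply: contraTT k0 => /qb_neq0[]; rewrite -leNgt. Qed.

Lemma qb0 x : x \is a Num.int -> 0 <= x -> qb x 0 = 1.
Proof.
move=> hx x0; rewrite /qb; have: x \is a Num.nat by rewrite natrEint hx.
move=> /natrP[n ->]; rewrite (qbin_nat n 0) leq0n subn0.
by rewrite [qfact q 0]/qfact big_geq // mul1r mulfV // qfact_neq0.
Qed.

Lemma qbin_pascal (n k : nat) :
  qbin q n.+1%:R k.+1%:R = q ^+ k.+1 * qbin q n%:R k.+1%:R + qbin q n%:R k%:R
  /\ ((k <= n)%N -> qbin q n.+1%:R k.+1%:R
                    = qbin q n%:R k.+1%:R + q ^+ (n - k) * qbin q n%:R k%:R).
Proof.
rewrite !qbin_nat ltnS subSS.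
have [kn|kn|->] := ltngtP k n.
- have [m nE] : {m | n = (k + m).+1}.
    by exists (n - k).-1; rewrite -addnS prednK ?subn_gt0 // subnKC // ltnW.
  have -> : (n - k = m.+1)%N by lia.
  have -> : (n - k.+1 = m)%N by lia.
  have := qfact_neq0 m; have := qfact_neq0 k.
  have := hq (ltn0Sn k); have := hq (ltn0Sn m).
  rewrite -![_ == 1]subr_eq0 !qfactS nE -addnS -addSn !exprD.
  set a := q ^+ m.+1; set b := q ^+ k.+1 => a1 b1 Qk Qm.
  have a1' : 1 - a != 0 by rewrite subr_eq0 eq_sym -subr_eq0.
  have b1' : 1 - b != 0 by rewrite subr_eq0 eq_sym -subr_eq0.
  split=> [|_]; field; by rewrite ?Qk ?Qm ?a1' ?b1'.
- by split; rewrite ?mulr0 ?addr0 // leqNgt kn.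
- rewrite subnn expr0 mulr0 !add0r mul1r.
  have Q0 : qfact q 0 = 1 by rewrite /qfact big_geq.
  by rewrite Q0 !mulr1 !mulfV ?qfact_neq0.
Qed.

(** The bound on [x] excludes [x = -1], [k = 0]: there the left-hand side is 1,
and the coefficients on the right vanish by convention. *)
Lemma qb_pascal x k : -1 < x ->
  qb (x + 1) k = pw k%:~R * qb x k + qb x (k - 1)
  /\ qb (x + 1) k = qb x k + pw (x + 1 - k%:~R) * qb x (k - 1).
Proof.
move=> x1; have [hx|hx] := boolP (x \is a Num.int); last first.
  have z y j : y \isn't a Num.int -> qb y j = 0.
    by move=> hy; apply/eqP; apply: contraNT hy => /qb_neq0[].
  by rewrite !z ?mulr0 ?addr0 // rpredDr.
case: k => [[|k]|k]; last first.
- by rewrite !qb_lt0 ?mulr0 ?addr0 //; lia.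
- have: x \is a Num.nat.
    rewrite natrEint hx; case/intrP: hx x1 => m ->.
    by rewrite -[-1]/((-1)%:~R) ltr_int ler0z; lia.
  case/natrP => n ->; rewrite natr1 /qb.
  have -> : Posz k.+1 - 1 = Posz k by lia.
  rewrite -!pmulrn pw_nat; have [h1 h2] := qbin_pascal n k; split=> //.
  have [kn|kn] := leqP k n.
    have -> : n.+1%:R - k.+1%:R = (n - k)%:R :> rat by rewrite natrB // -!natr1; ring.
    by rewrite h2 // pw_nat.
  by rewrite !qbin_nat ltnS [(k < n)%N]ltnNge (ltnW kn) /= leqNgt kn mulr0 addr0.
- have: x \is a Num.nat.
    rewrite natrEint hx; case/intrP: hx x1 => m ->.
    by rewrite -[-1]/((-1)%:~R) ltr_int ler0z; lia.
  move=> /natr_ge0 x0.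
  rewrite -[Posz 0]/(0 : int) [qb x (0 - 1)]qb_lt0 //.
  by rewrite !qb0 ?rpredD ?addr_ge0 // pw0 !mulr0 mulr1 !addr0.
Qed.

(** * Finitely supported sums over the integers *)

Definition fsupp (u : int -> F) : Prop :=
  exists n : int, forall t, u t != 0 -> - n <= t <= n.

Definition zsum (u : int -> F) : F := \sum_(t \in [set: int]) u t.

Lemma finite_zinterval (n : int) : finite_set [set t : int | - n <= t <= n].
Proof.
apply: (@sub_finite_set _ _
  ((fun k : nat => k%:Z - n) @` `I_(`|n|.*2.+1))) => [t /= /andP[t1 t2]|].
  by exists (absz (t + n)) => /=; lia.
exact/finite_image/finite_II.
Qed.

Lemma zsum_interval u n : (forall t, u t != 0 -> - n <= t <= n) ->
  zsum u = \sum_(t \in [set t : int | - n <= t <= n]) u t.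
Proof.
move=> hn; apply/esym/fsbig_widen => // t [_ /= ht].
by apply/eqP; apply: contra_notT ht; apply: hn.
Qed.

Lemma zsumD u v : fsupp u -> fsupp v ->
  zsum (fun t => u t + v t) = zsum u + zsum v.
Proof.
move=> [n hn] [m hm]; pose k := `|n| + `|m|.
have ku t : u t != 0 -> - k <= t <= k by move=> /hn; rewrite /k; lia.
have kv t : v t != 0 -> - k <= t <= k by move=> /hm; rewrite /k; lia.
rewrite (zsum_interval ku) (zsum_interval kv) -fsbig_split.
  apply: zsum_interval => t; have [->|/ku//] := eqVneq (u t) 0.
  by rewrite add0r => /kv.
exact: finite_zinterval.
Qed.

Lemma zsumZ c u : zsum (fun t => c * u t) = c * zsum u.
Proof. by rewrite /zsum mulr_fsumr. Qed.

Lemma zsum_shift u a : zsum (fun t => u (t + a)) = zsum u.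
Proof.
by rewrite /zsum (@reindex_fsbigT _ _ _ _ _ (fun t => t + a) u) //;
  exists (fun t => t - a) => t; rewrite ?addrK ?subrK.
Qed.

Lemma eq_zsum u v : u =1 v -> zsum u = zsum v.
Proof. by move=> h; congr zsum; apply/funext. Qed.

Lemma fsuppM u v : fsupp v -> fsupp (fun t => u t * v t).
Proof.
by move=> [n hn]; exists n => t; rewrite mulf_eq0 negb_or => /andP[_ /hn].
Qed.

Lemma fsuppD u v : fsupp u -> fsupp v -> fsupp (fun t => u t + v t).
Proof.
move=> [n hn] [m hm]; exists (`|n| + `|m|) => t.
have [->|/hn] := eqVneq (u t) 0; last by lia.
by rewrite add0r => /hm; lia.
Qed.

Lemma fsupp_shift u a : fsupp u -> fsupp (fun t => u (t + a)).
Proof. by move=> [n hn]; exists (`|n| + `|a|) => t /hn; lia. Qed.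

Lemma zsum_lin3 a b c u v w : fsupp u -> fsupp v -> fsupp w ->
  zsum (fun t => a * u t + b * v t + c * w t)
  = a * zsum u + b * zsum v + c * zsum w.
Proof.
move=> fu fv fw; rewrite zsumD; [|by apply: fsuppD; exact: fsuppM|exact: fsuppM].
by rewrite zsumD ?zsumZ //; exact: fsuppM.
Qed.

Lemma zsum_single u j : (forall k, k != j -> u k = 0) -> zsum u = u j.
Proof.
move=> h; rewrite /zsum -(fsbig_widen [set j] setT) ?fsbig_set1 // => k [_ /= kj].
by apply/h/eqP.
Qed.

Lemma fsupp_between u (a b : int) : (forall k, k < a -> u k = 0) ->
  (forall k, b < k -> u k = 0) -> fsupp u.
Proof.
move=> ha hb; exists (`|a| + `|b|) => k uk.
have [/ha k0|ka] := ltP k a; first by rewrite k0 eqxx in uk.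
have [/hb k0|kb] := ltP b k; first by rewrite k0 eqxx in uk.
by lia.
Qed.

(** [node_sum x k u] couples the variable [t] to a node with bottom entry [k] and
half-integral inhomogeneity [x]. *)
Definition node_sum (x : rat) (k : int) (u : int -> F) : F :=
  zsum (fun t => qb (x + t%:~R / 2) k * u t).

Lemma node_sumD x k u v : fsupp u -> fsupp v ->
  node_sum x k (fun t => u t + v t) = node_sum x k u + node_sum x k v.
Proof.
move=> hu hv; rewrite /node_sum -zsumD; [|exact: fsuppM|exact: fsuppM].
by apply: eq_zsum => t; rewrite mulrDr.
Qed.

Lemma node_sumZ x k c u : node_sum x k (fun t => c * u t) = c * node_sum x k u.
Proof. by rewrite /node_sum -zsumZ; apply: eq_zsum => t; rewrite mulrCA. Qed.

Lemma eq_node_sum x k u v : u =1 v -> node_sum x k u = node_sum x k v.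
Proof. by move=> h; congr node_sum; apply/funext. Qed.

Lemma node_sum_shift x k u (a : int) :
  node_sum x k (fun t => u (t + a)) = node_sum (x - a%:~R / 2) k u.
Proof.
rewrite /node_sum -[RHS](zsum_shift _ a); apply: eq_zsum => t.
by rewrite rmorphD /=; congr (qb _ _ * _); ring.
Qed.

Lemma node_sum_pascal1 x k u : -1 < x -> fsupp u -> (forall t, t < 0 -> u t = 0) ->
  node_sum (x + 1) k u = pw k%:~R * node_sum x k u + node_sum x (k - 1) u.
Proof.
move=> x1 hu u0; rewrite /node_sum -zsumZ -zsumD;
  [|by do ?apply: fsuppM|by do ?apply: fsuppM].
apply: eq_zsum => t; have [t0|t0] := ltP t 0; first by rewrite u0 // !mulr0 addr0.
have t0' : 0 <= t%:~R / 2 :> rat by rewrite divr_ge0 // ler0z.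
have [|+ _] := @qb_pascal (x + t%:~R / 2) k; first by lra.
by rewrite addrAC => ->; ring.
Qed.

Lemma node_sum_pascal2 x k u : -1 < x -> fsupp u -> (forall t, t < 0 -> u t = 0) ->
  node_sum (x + 1) k u = node_sum x k u
    + pw (x + 1 - k%:~R) * node_sum x (k - 1) (fun t => pw (t%:~R / 2) * u t).
Proof.
move=> x1 hu u0; rewrite /node_sum -zsumZ -zsumD;
  [|by do ?apply: fsuppM|by do ?apply: fsuppM].
apply: eq_zsum => t; have [t0|t0] := ltP t 0; first by rewrite u0 // !mulr0 addr0.
have t0' : 0 <= t%:~R / 2 :> rat by rewrite divr_ge0 // ler0z.
have [|_ +] := @qb_pascal (x + t%:~R / 2) k; first by lra.
rewrite addrAC => ->.
have -> : x + 1 + t%:~R / 2 - k%:~R = (x + 1 - k%:~R) + t%:~R / 2 by ring.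
by rewrite pwD; ring.
Qed.

(** * The transfer operation and two operators that commute with it *)

Definition edge (r s : int) : F := pw ((r%:~R - s%:~R) ^+ 2 / 4).

Definition transfer (phi : int -> int -> F) (r s : int) : F :=
  edge r s * node_sum (r%:~R / 2) s (phi s).

(** For [q = 1] the generating functions of the chains are governed by the
recurrence [Q_j^2 = 1 + Q_(j-1) Q_(j+1)], which conserves
[(Q_(j-1) + Q_(j+1)) / Q_j].  Eliminating one of the three variables leaves a
Laurent polynomial with three terms, and this operator quantizes it. *)
Definition opA (phi : int -> int -> F) (r s : int) : F :=
  phi (r - 1) (s - 1) + phi (r + 1) (s + 1)
  - pw r%:~R * phi (r - 1) (s + 1).

(** The counterpart of [opA] under [q -> 1/q], which exchanges the two forms of
q-Pascal. *)
Definition opB (phi : int -> int -> F) (r s : int) : F :=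
  pw ((r%:~R - s%:~R) / 2) * phi (r - 1) (s - 1)
  + pw ((s%:~R - r%:~R) / 2) * phi (r + 1) (s + 1)
  - pw ((r%:~R - s%:~R) / 2 - 1) * phi (r - 1) (s + 1).

Lemma edge_diag r s a : edge (r + a) (s + a) = edge r s.
Proof. by rewrite /edge !rmorphD /=; congr pw; ring. Qed.

Lemma edge_anti r s : edge (r - 1) (s + 1) = pw (1 + s%:~R - r%:~R) * edge r s.
Proof. by rewrite /edge -pwD !rmorphD rmorphN /=; congr pw; field. Qed.

(** After shifting the summation index, the terms in [phi (k - 1)] combine by
q-Pascal at the node [k], and so do the terms on the right in [phi (k + 1)] at
the node [k + 1]. *)
Lemma node_sum_opA phi x k : 0 <= x ->
  (forall s, fsupp (phi s)) -> (forall s t, t < 0 -> phi s t = 0) ->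
  node_sum x k (opA phi k) = node_sum (x - 1 / 2) (k - 1) (phi (k - 1))
    + node_sum (x + 1 / 2) (k + 1) (phi (k + 1))
    - pw (k + 1)%:~R * node_sum (x - 1 / 2) (k + 1) (phi (k + 1)).
Proof.
move=> x0 fs neg; have y1 : -1 < x - 1 / 2 by lra.
rewrite /opA.
rewrite (@eq_node_sum _ _ _ (fun t => (phi (k - 1) (t - 1) + phi (k + 1) (t + 1))
   + (- pw k%:~R) * phi (k - 1) (t + 1))); last by move=> t; rewrite mulNr.
have fs1 := fsupp_shift (-1) (fs (k - 1)).
have fs2 := fsupp_shift 1 (fs (k + 1)).
have fs3 := fsupp_shift 1 (fs (k - 1)).
rewrite node_sumD; [|exact: fsuppD|exact: fsuppM].
rewrite node_sumD // node_sumZ !node_sum_shift.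
have e1 : x - (-1)%:~R / 2 = x - 1 / 2 + 1 by rewrite rmorphN /=; field.
have e2 : x + 1 / 2 = x - 1 / 2 + 1 by field.
have e3 : x - 1%:~R / 2 = x - 1 / 2 by [].
rewrite e1 ?e2 ?e3 {e1 e2 e3}.
rewrite node_sum_pascal1 //; last exact: neg.
rewrite (node_sum_pascal1 (k + 1)) //; last exact: neg.
by rewrite addrK; ring.
Qed.

Lemma node_sum_opB phi x k : 0 <= x ->
  (forall s, fsupp (phi s)) -> (forall s t, t < 0 -> phi s t = 0) ->
  node_sum x k (opB phi k) =
    pw (x - k%:~R / 2) * node_sum (x - 1 / 2) (k - 1) (phi (k - 1))
    + pw (k%:~R / 2 - x) * (node_sum (x + 1 / 2) (k + 1) (phi (k + 1))
                          - node_sum (x - 1 / 2) (k + 1) (phi (k + 1))).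
Proof.
move=> x0 fs neg; have y1 : -1 < x - 1 / 2 by lra.
(* The powers of q in opB depend on the summation index; they are what is needed
   for the first and the last term to be shifts of one function v. *)
pose v t := pw ((k%:~R - 1 - t%:~R) / 2) * phi (k - 1) t.
pose w t := pw ((t%:~R - 1 - k%:~R) / 2) * phi (k + 1) t.
have fv : fsupp v by apply: fsuppM.
have fw : fsupp w by apply: fsuppM.
rewrite /opB.
rewrite (@eq_node_sum _ _ _
  (fun t => (v (t - 1) + w (t + 1)) + (-1) * v (t + 1))); last first.
  move=> t; rewrite /v /w mulN1r !rmorphD rmorphN /=.
  by congr (pw _ * _ + pw _ * _ - pw _ * _); field.
have fs1 := fsupp_shift (-1) fv.
have fs2 := fsupp_shift 1 fw.
have fs3 := fsupp_shift 1 fv.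
rewrite node_sumD; [|exact: fsuppD|exact: fsuppM].
rewrite node_sumD // node_sumZ !node_sum_shift.
have e1 : x - (-1)%:~R / 2 = x - 1 / 2 + 1 by rewrite rmorphN /=; field.
have e2 : x + 1 / 2 = x - 1 / 2 + 1 by field.
have e3 : x - 1%:~R / 2 = x - 1 / 2 by [].
rewrite e1 ?e2 ?e3 {e1 e2 e3}.
rewrite node_sum_pascal2 //; last by move=> t t0; rewrite /v neg ?mulr0.
rewrite (node_sum_pascal2 (k + 1)) //; last exact: neg.
rewrite addrK.
have -> : node_sum (x - 1 / 2) (k - 1) (fun t => pw (t%:~R / 2) * v t)
  = pw ((k%:~R - 1) / 2) * node_sum (x - 1 / 2) (k - 1) (phi (k - 1)).
  rewrite -node_sumZ; apply: eq_node_sum => t; rewrite /v mulrA -pwD.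
  by congr (pw _ * _); field.
have -> : node_sum (x - 1 / 2) k w = pw (- (1 + k%:~R) / 2)
    * node_sum (x - 1 / 2) k (fun t => pw (t%:~R / 2) * phi (k + 1) t).
  rewrite -node_sumZ; apply: eq_node_sum => t; rewrite /w mulrA -pwD.
  by congr (pw _ * _); field.
have -> : pw (x - k%:~R / 2)
  = pw (x - 1 / 2 + 1 - k%:~R) * pw ((k%:~R - 1) / 2).
  by rewrite -pwD; congr pw; field.
have -> : pw (- (1 + k%:~R) / 2)
  = pw (k%:~R / 2 - x) * pw (x - 1 / 2 + 1 - (k + 1)%:~R).
  by rewrite -pwD rmorphD /=; congr pw; field.
by ring.
Qed.

Lemma transfer_opA phi r s : 0 <= r ->
  (forall s, fsupp (phi s)) -> (forall s t, t < 0 -> phi s t = 0) ->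
  transfer (opA phi) r s = opA (transfer phi) r s.
Proof.
move=> r0 fs neg; rewrite [LHS]/transfer node_sum_opA ?divr_ge0 ?ler0z //.
rewrite /opA /transfer !edge_diag edge_anti !rmorphD rmorphN /=.
have -> : (r%:~R + 1) / 2 = r%:~R / 2 + 1 / 2 :> rat by ring.
have -> : (r%:~R - 1) / 2 = r%:~R / 2 - 1 / 2 :> rat by ring.
have -> : pw (s%:~R + 1) = pw r%:~R * pw (1 + s%:~R - r%:~R).
  by rewrite -pwD; congr pw; ring.
by ring.
Qed.

Lemma transfer_opB phi r s : 0 <= r ->
  (forall s, fsupp (phi s)) -> (forall s t, t < 0 -> phi s t = 0) ->
  transfer (opB phi) r s = opB (transfer phi) r s.
Proof.
move=> r0 fs neg; rewrite [LHS]/transfer node_sum_opB ?divr_ge0 ?ler0z //.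
rewrite /opB /transfer !edge_diag edge_anti !rmorphD rmorphN /=.
have -> : (r%:~R + 1) / 2 = r%:~R / 2 + 1 / 2 :> rat by ring.
have -> : (r%:~R - 1) / 2 = r%:~R / 2 - 1 / 2 :> rat by ring.
have -> : r%:~R / 2 - s%:~R / 2 = (r%:~R - s%:~R) / 2 :> rat by ring.
have -> : s%:~R / 2 - r%:~R / 2 = (s%:~R - r%:~R) / 2 :> rat by ring.
have -> : pw ((s%:~R - r%:~R) / 2)
  = pw ((r%:~R - s%:~R) / 2 - 1) * pw (1 + s%:~R - r%:~R).
  by rewrite -pwD; congr pw; field.
by ring.
Qed.

(** * Chains that end at a fixed height *)

(** The chains are [r, s, ..., B], with [n + 1] edges.  The factor [e] is a
function of the last height before [B]: it is a q-binomial in one application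
and 1 in the other. *)
Fixpoint chain (B : int) (e : int -> F) (n : nat) : int -> int -> F :=
  if n is n'.+1 then transfer (chain B e n')
  else fun r s => if s == B then edge r s * e r else 0.

(** The end node [B] has itself a q-binomial, whose top entry involves the height
before [B] and the inhomogeneity [y]. *)
Definition rchain (n : nat) (B : int) (y : rat) : int -> int -> F :=
  chain B (fun r => qb (y + r%:~R / 2) B) n.

Lemma node_sum_neq0 x k u : node_sum x k u != 0 ->
  exists t, qb (x + t%:~R / 2) k != 0 /\ u t != 0.
Proof.
apply: contraNP => h; apply/eqP/fsbig1 => t _.
apply/eqP; rewrite mulf_eq0 -[_ || _]negbK negb_or.
by apply/negP => /andP[h1 h2]; apply: h; exists t.
Qed.

(** A nonzero weight forces [2 s <= r + t] for consecutive heights, that is,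
convexity; hence no height exceeds both ends. *)
Lemma chain_supp B e n r s : (0 <= B \/ forall t, e t = 0) ->
  chain B e n r s != 0 -> 0 <= s /\ (s <= r \/ s <= B).
Proof.
move=> hB; elim: n r s => [|n IHn] r s /=.
  case: (s =P B) => [-> h|_]; last by rewrite eqxx.
  by case: hB h => [|->]; [split; [|right]|rewrite mulr0 eqxx].
rewrite mulf_eq0 negb_or => /andP[_ /node_sum_neq0[t [/qb_neq0[s0 st _] /IHn[t0 ht]]]].
split=> //; have: s%:~R * 2 <= (r + t)%:~R :> rat.
  by rewrite rmorphD /= -ler_pdivlMr // mulrDl.
rewrite -[2]/(2%:~R) -rmorphM /= ler_int => st'.
have [sr|sr] := leP s r; first by left.
by right; case: ht; lia.
Qed.

Lemma eq_transfer phi phi' r s : (0 <= s -> phi s =1 phi' s) ->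
  transfer phi r s = transfer phi' r s.
Proof.
move=> h; congr (_ * _); have [s0|/h s0] := ltP s 0; last exact: eq_node_sum.
by apply: eq_zsum => t; rewrite !qb_lt0 // !mul0r.
Qed.

Lemma transfer_lin3 a b c r1 r2 r3 r s :
  fsupp (r1 s) -> fsupp (r2 s) -> fsupp (r3 s) ->
  transfer (fun s t => a * r1 s t + b * r2 s t + c * r3 s t) r s
  = a * transfer r1 r s + b * transfer r2 r s + c * transfer r3 r s.
Proof.
move=> f1 f2 f3; rewrite /transfer node_sumD;
  [|by apply: fsuppD; exact: fsuppM|exact: fsuppM].
by rewrite node_sumD; [rewrite !node_sumZ; ring|exact: fsuppM|exact: fsuppM].
Qed.

Lemma rchain_supp n B y r s : rchain n B y r s != 0 -> 0 <= s /\ (s <= r \/ s <= B).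
Proof.
apply: chain_supp; have [B0|B0] := ltP B 0; last by left.
by right=> t; rewrite qb_lt0.
Qed.

Lemma rchain_fsupp n B y r : fsupp (rchain n B y r).
Proof. by exists (`|r| + `|B|) => t /rchain_supp; lia. Qed.

Lemma rchain_lt0 n B y r s : s < 0 -> rchain n B y r s = 0.
Proof. by move=> s0; apply/eqP; apply: contraTT s0 => /rchain_supp[]; rewrite -leNgt. Qed.

(** On a single edge this is q-Pascal at the end node; longer chains follow since
[opA] commutes with the transfer operation.  As [y] tends to infinity and the
factor [1 / (q)_B] is removed, the right-hand side becomes the recurrence
[H_(B+1) + (1 - q^B) H_(B-1)] of the continuous q-Hermite polynomials. *)
Lemma rchain_opA n B y r s : 0 <= r -> 0 <= y ->
  opA (rchain n B y) r s = rchain n (B - 1) (y - 1 / 2) r s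
    + rchain n (B + 1) (y + 1 / 2) r s
    - pw (B + 1)%:~R * rchain n (B + 1) (y - 1 / 2) r s.
Proof.
move=> r0 y0; elim: n r s r0 => [|n IHn] r s r0; last first.
  rewrite -[LHS]/(opA (transfer (rchain n B y)) r s) -transfer_opA //; last first.
  - exact: rchain_lt0.
  - exact: rchain_fsupp.
  rewrite (@eq_transfer _ (fun s t => 1 * rchain n (B - 1) (y - 1 / 2) s t
    + 1 * rchain n (B + 1) (y + 1 / 2) s t
    + (- pw (B + 1)%:~R) * rchain n (B + 1) (y - 1 / 2) s t)).
    rewrite transfer_lin3; try exact: rchain_fsupp.
    by rewrite !mul1r mulNr.
  by move=> s0 t; rewrite IHn // !mul1r mulNr.
have r0' : 0 <= r%:~R :> rat by rewrite ler0z.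
have [|p1 _] := @qb_pascal (y - 1 / 2 + r%:~R / 2) B; first by lra.
have [|p2 _] := @qb_pascal (y - 1 / 2 + r%:~R / 2) (B + 1); first by lra.
rewrite /opA /rchain /= edge_anti !edge_diag.
have -> : y + (r - 1)%:~R / 2 = y - 1 / 2 + r%:~R / 2.
  by rewrite rmorphD rmorphN /=; field.
have -> : y + (r + 1)%:~R / 2 = y - 1 / 2 + r%:~R / 2 + 1.
  by rewrite rmorphD /=; field.
have -> : y + 1 / 2 + r%:~R / 2 = y - 1 / 2 + r%:~R / 2 + 1 by field.
rewrite p1 p2 addrK.
have -> : (s - 1 == B) = (s == B + 1) by apply/eqP/eqP; lia.
have -> : (s + 1 == B) = (s == B - 1) by apply/eqP/eqP; lia.
have [->|_] := eqVneq s (B + 1).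
  have -> : (B + 1 == B - 1) = false by apply/eqP; lia.
  by ring.
case: (s =P B - 1) => [->|_]; last by ring.
have -> : pw B%:~R = pw r%:~R * pw (1 + (B - 1)%:~R - r%:~R).
  by rewrite -pwD rmorphD rmorphN /=; congr pw; ring.
by ring.
Qed.

Lemma rchain_opB n B y r s : 0 <= r -> 0 <= y ->
  opB (rchain n B y) r s = pw (y - B%:~R / 2) * rchain n (B - 1) (y - 1 / 2) r s
    + pw (B%:~R / 2 - y) * (rchain n (B + 1) (y + 1 / 2) r s
                           - rchain n (B + 1) (y - 1 / 2) r s).
Proof.
move=> r0 y0; elim: n r s r0 => [|n IHn] r s r0; last first.
  rewrite -[LHS]/(opB (transfer (rchain n B y)) r s) -transfer_opB //; last first.
  - exact: rchain_lt0.
  - exact: rchain_fsupp.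
  rewrite (@eq_transfer _ (fun s t =>
    pw (y - B%:~R / 2) * rchain n (B - 1) (y - 1 / 2) s t
    + pw (B%:~R / 2 - y) * rchain n (B + 1) (y + 1 / 2) s t
    + (- pw (B%:~R / 2 - y)) * rchain n (B + 1) (y - 1 / 2) s t)).
    rewrite transfer_lin3; try exact: rchain_fsupp.
    by rewrite /rchain /=; ring.
  by move=> s0 t; rewrite IHn //; ring.
have r0' : 0 <= r%:~R :> rat by rewrite ler0z.
have [|_ p1] := @qb_pascal (y - 1 / 2 + r%:~R / 2) B; first by lra.
have [|_ p2] := @qb_pascal (y - 1 / 2 + r%:~R / 2) (B + 1); first by lra.
rewrite /opB /rchain /= edge_anti !edge_diag.
have -> : y + (r - 1)%:~R / 2 = y - 1 / 2 + r%:~R / 2.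
  by rewrite rmorphD rmorphN /=; field.
have -> : y + (r + 1)%:~R / 2 = y - 1 / 2 + r%:~R / 2 + 1.
  by rewrite rmorphD /=; field.
have -> : y + 1 / 2 + r%:~R / 2 = y - 1 / 2 + r%:~R / 2 + 1 by field.
rewrite p1 p2 addrK.
have -> : (s - 1 == B) = (s == B + 1) by apply/eqP/eqP; lia.
have -> : (s + 1 == B) = (s == B - 1) by apply/eqP/eqP; lia.
have [->|_] := eqVneq s (B + 1).
  have -> : (B + 1 == B - 1) = false by apply/eqP; lia.
  have -> : pw ((r%:~R - (B + 1)%:~R) / 2)
    = pw (B%:~R / 2 - y) * pw (y - 1 / 2 + r%:~R / 2 + 1 - (B + 1)%:~R).
    by rewrite -pwD rmorphD /=; congr pw; field.
  by ring.
case: (s =P B - 1) => [->|_]; last by ring.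
have -> : pw (y - B%:~R / 2) = pw (((B - 1)%:~R - r%:~R) / 2)
    * pw (y - 1 / 2 + r%:~R / 2 + 1 - B%:~R).
  by rewrite -pwD rmorphD rmorphN /=; congr pw; field.
have -> : pw (((B - 1)%:~R - r%:~R) / 2) = pw ((r%:~R - (B - 1)%:~R) / 2 - 1)
    * pw (1 + (B - 1)%:~R - r%:~R).
  by rewrite -pwD rmorphD rmorphN /=; congr pw; field.
by ring.
Qed.

(** * The cycle sum *)

(** The right-hand side of the identity, up to a power of [q], for
[x = L1 + B / 2] and [y = L2 + A / 2]. *)
Definition cycle_sum (n : nat) (x : rat) (A B : int) (y : rat) : F :=
  node_sum x A (rchain n B y A).

(** Both sides are the value of [opA] applied next to the end [A]: on the left it
is absorbed by the end [A], on the right it has been moved to the end [B]. *)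
Lemma cycle_sum_relA n x A B y : 0 <= A -> 0 <= x -> 0 <= y ->
  cycle_sum n (x - 1 / 2) (A - 1) B y + cycle_sum n (x + 1 / 2) (A + 1) B y
    - pw (A + 1)%:~R * cycle_sum n (x - 1 / 2) (A + 1) B y
  = cycle_sum n x A (B - 1) (y - 1 / 2) + cycle_sum n x A (B + 1) (y + 1 / 2)
    - pw (B + 1)%:~R * cycle_sum n x A (B + 1) (y - 1 / 2).
Proof.
move=> A0 x0 y0; rewrite -node_sum_opA //;
  try by move=> *; rewrite ?rchain_lt0 //; exact: rchain_fsupp.
rewrite (@eq_node_sum _ _ _ (fun t => (rchain n (B - 1) (y - 1 / 2) A t
    + rchain n (B + 1) (y + 1 / 2) A t)
    + (- pw (B + 1)%:~R) * rchain n (B + 1) (y - 1 / 2) A t)); last first.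
  by move=> t; rewrite rchain_opA // mulNr.
have fs := rchain_fsupp; rewrite node_sumD; [|exact: fsuppD|exact: fsuppM].
by rewrite node_sumD // node_sumZ mulNr.
Qed.

Lemma cycle_sum_relB n x A B y : 0 <= A -> 0 <= x -> 0 <= y ->
  pw (x - A%:~R / 2) * cycle_sum n (x - 1 / 2) (A - 1) B y
    + pw (A%:~R / 2 - x) * (cycle_sum n (x + 1 / 2) (A + 1) B y
                           - cycle_sum n (x - 1 / 2) (A + 1) B y)
  = pw (y - B%:~R / 2) * cycle_sum n x A (B - 1) (y - 1 / 2)
    + pw (B%:~R / 2 - y) * (cycle_sum n x A (B + 1) (y + 1 / 2)
                           - cycle_sum n x A (B + 1) (y - 1 / 2)).
Proof.
move=> A0 x0 y0; rewrite -node_sum_opB //;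
  try by move=> *; rewrite ?rchain_lt0 //; exact: rchain_fsupp.
rewrite (@eq_node_sum _ _ _ (fun t =>
    (pw (y - B%:~R / 2) * rchain n (B - 1) (y - 1 / 2) A t
    + pw (B%:~R / 2 - y) * rchain n (B + 1) (y + 1 / 2) A t)
    + (- pw (B%:~R / 2 - y)) * rchain n (B + 1) (y - 1 / 2) A t)); last first.
  by move=> t; rewrite rchain_opB //; ring.
have fsM c B' y' := @fsuppM (fun=> c) _ (rchain_fsupp n B' y' A).
by rewrite node_sumD; [rewrite node_sumD // !node_sumZ /cycle_sum; ring|exact: fsuppD|].
Qed.

(** * The forked sum *)

Definition chain0 (n : nat) : int -> int -> F := chain 0 (fun=> 1) n.

Lemma chain0_supp n r s : chain0 n r s != 0 -> 0 <= s /\ (s <= r \/ s <= 0).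
Proof. by apply: chain_supp; left. Qed.

Lemma chain0_fsupp n r : fsupp (chain0 n r).
Proof. by exists `|r| => t /chain0_supp; lia. Qed.

Lemma chain0_lt0 n r s : s < 0 -> chain0 n r s = 0.
Proof. by move=> s0; apply/eqP; apply: contraTT s0 => /chain0_supp[]; rewrite -leNgt. Qed.

(** The node before the chain is split into two nodes with bottom entries [a] and
[b], so the chain starts at the height [a + b]. *)
Definition fork (n : nat) (x y : rat) (a b : int) : F :=
  node_sum x a (fun s => qb (y + s%:~R / 2) b * chain0 n (a + b) s).

Lemma forkC n x y a b : fork n x y a b = fork n y x b a.
Proof. by rewrite /fork /node_sum addrC; apply: eq_zsum => s; rewrite mulrCA. Qed.

Lemma fork_lt0 n x y a b : b < 0 -> fork n x y a b = 0.
Proof.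
by move=> b0; apply: fsbig1 => s _; rewrite [qb (y + _) _]qb_lt0 // !(mul0r, mulr0).
Qed.

(** The chain starts at [a + b + 1] in all terms.  By q-Pascal at the first node
the left-hand side is the sum for the bottom entries [a] and [b] with the same
chain, which is symmetric. *)
Lemma fork_relA n x y a b : 0 <= x -> 0 <= y ->
  fork n (x + 1) y (a + 1) b - pw (a + 1)%:~R * fork n x y (a + 1) b
  = fork n x (y + 1) a (b + 1) - pw (b + 1)%:~R * fork n x y a (b + 1).
Proof.
pose g x y a b := node_sum x a (fun s => qb (y + s%:~R / 2) b * chain0 n (a + b + 1) s).
have h x' y' a' b' : 0 <= x' ->
    fork n (x' + 1) y' (a' + 1) b' - pw (a' + 1)%:~R * fork n x' y' (a' + 1) b'
    = g x' y' a' b'.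
  move=> x0; rewrite /fork node_sum_pascal1; first last.
  - by move=> t t0; rewrite chain0_lt0 ?mulr0.
  - exact/fsuppM/chain0_fsupp.
  - by lra.
  by rewrite addrAC subrr add0r addrK addrAC.
move=> x0 y0; rewrite h // forkC [fork n x y a _]forkC h //.
by rewrite /g /node_sum [b + a]addrC; apply: eq_zsum => s; rewrite mulrCA.
Qed.

Lemma fork_relB n x y a b : 0 <= x -> 0 <= y ->
  pw (a%:~R - x) * (fork n (x + 1) y (a + 1) b - fork n x y (a + 1) b)
  = pw (b%:~R - y) * (fork n x (y + 1) a (b + 1) - fork n x y a (b + 1)).
Proof.
pose g x y a b := node_sum x a (fun s => pw (s%:~R / 2)
  * (qb (y + s%:~R / 2) b * chain0 n (a + b + 1) s)).
have h x' y' a' b' : 0 <= x' ->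
    pw (a'%:~R - x') * (fork n (x' + 1) y' (a' + 1) b' - fork n x' y' (a' + 1) b')
    = g x' y' a' b'.
  move=> x0; rewrite /fork node_sum_pascal2; first last.
  - by move=> t t0; rewrite chain0_lt0 ?mulr0.
  - exact/fsuppM/chain0_fsupp.
  - by lra.
  rewrite addrAC subrr add0r addrK [_ + 1 + b']addrAC mulrA -pwD.
  rewrite (_ : pw _ = 1) ?mul1r // -pw0 rmorphD /=; congr pw; ring.
move=> x0 y0; rewrite h // forkC [fork n x y a _]forkC h //.
by rewrite /g /node_sum [b + a]addrC; apply: eq_zsum => s; ring.
Qed.

(** The left-hand side of the identity, up to a power of [q], for [A = M + l] and
[B = M]; the index is [k = M - i]. *)
Definition fork_sum (n : nat) (x y : rat) (A B : int) : F :=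
  zsum (fun k => qb (x + y + k%:~R) k * fork n x y (A - k) (B - k)).

Lemma fork_sum_shift n x y A B : fork_sum n x y A B =
  zsum (fun k => qb (x + y + k%:~R - 1) (k - 1)
               * fork n x y (A - k + 1) (B - k + 1)).
Proof.
rewrite /fork_sum -[LHS](zsum_shift _ (-1)); apply: eq_zsum => k.
by rewrite rmorphD rmorphN /= !addrA !opprD !opprK !addrA.
Qed.

Lemma fork_sum_fsupp n x y a b (g : int -> rat) c d e :
  fsupp (fun k => qb (g k) (k + c) * fork n x y (a - k + d) (b - k + e)).
Proof.
apply: (@fsupp_between _ (- c) (b + e)) => k hk; first by rewrite qb_lt0 ?mul0r //; lia.
by rewrite fork_lt0 ?mulr0 //; lia.
Qed.

(** The relations of [cycle_sum_relA] and [cycle_sum_relB]. They hold for each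
[k] separately: after a shift of [k] in two terms, all six contain the chains
that start at [A + B + 1 - 2 k], the forks are related by [fork_relA] and
[fork_relB], and the weights [k0], [k1], [kk] of the sum over [k] by q-Pascal.
The arguments [x] and [y] are the smallest inhomogeneities that occur, whence
the terms 1/2. *)
Lemma fork_sum_relations n x y A B : 0 <= x -> 0 <= y ->
  fork_sum n x (y + 1) (A - 1) B + fork_sum n (x + 1) y (A + 1) B
    - pw (A + 1)%:~R * fork_sum n x y (A + 1) B
  = fork_sum n (x + 1) y A (B - 1) + fork_sum n x (y + 1) A (B + 1)
    - pw (B + 1)%:~R * fork_sum n x y A (B + 1)
  /\
  pw (x + 1 / 2 + (B%:~R - A%:~R) / 2) * fork_sum n x (y + 1) (A - 1) B
    + pw (- (x + 1 / 2 + (B%:~R - A%:~R) / 2))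
      * (fork_sum n (x + 1) y (A + 1) B - fork_sum n x y (A + 1) B)
  = pw (y + 1 / 2 + (A%:~R - B%:~R) / 2) * fork_sum n (x + 1) y A (B - 1)
    + pw (- (y + 1 / 2 + (A%:~R - B%:~R) / 2))
      * (fork_sum n x (y + 1) A (B + 1) - fork_sum n x y A (B + 1)).
Proof.
move=> x0 y0.
pose k1 k := qb (x + y + k%:~R) (k - 1).
pose k0 k := qb (x + y + k%:~R) (k + 0).
pose kk k := qb (x + y + k%:~R + 1) (k + 0).
pose fa x y k := fork n x y (A - k + 1) (B - k + 0).
pose fb x y k := fork n x y (A - k + 0) (B - k + 1).
(* Shifting k in two of the sums aligns the starting heights of the chains. *)
have -> : fork_sum n x (y + 1) (A - 1) B = zsum (fun k => k1 k * fb x (y + 1) k).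
  rewrite fork_sum_shift; apply: eq_zsum => k; rewrite /k1 /fb.
  by congr (qb _ _ * fork _ _ _ _ _); ring.
have -> : fork_sum n (x + 1) y A (B - 1) = zsum (fun k => k1 k * fa (x + 1) y k).
  rewrite fork_sum_shift; apply: eq_zsum => k; rewrite /k1 /fa.
  by congr (qb _ _ * fork _ _ _ _ _); ring.
have -> : fork_sum n (x + 1) y (A + 1) B = zsum (fun k => kk k * fa (x + 1) y k).
  apply: eq_zsum => k; rewrite /kk /fa.
  by congr (qb _ _ * fork _ _ _ _ _); ring.
have -> : fork_sum n x (y + 1) A (B + 1) = zsum (fun k => kk k * fb x (y + 1) k).
  apply: eq_zsum => k; rewrite /kk /fb.
  by congr (qb _ _ * fork _ _ _ _ _); ring.
have -> : fork_sum n x y (A + 1) B = zsum (fun k => k0 k * fa x y k).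
  apply: eq_zsum => k; rewrite /k0 /fa.
  by congr (qb _ _ * fork _ _ _ _ _); ring.
have -> : fork_sum n x y A (B + 1) = zsum (fun k => k0 k * fb x y k).
  apply: eq_zsum => k; rewrite /k0 /fb.
  by congr (qb _ _ * fork _ _ _ _ _); ring.
have f1 z w : fsupp (fun k => k1 k * fa z w k) by exact: fork_sum_fsupp.
have f2 z w : fsupp (fun k => k1 k * fb z w k) by exact: fork_sum_fsupp.
have f3 z w : fsupp (fun k => k0 k * fa z w k) by exact: fork_sum_fsupp.
have f4 z w : fsupp (fun k => k0 k * fb z w k) by exact: fork_sum_fsupp.
have f5 z w : fsupp (fun k => kk k * fa z w k) by exact: fork_sum_fsupp.
have f6 z w : fsupp (fun k => kk k * fb z w k) by exact: fork_sum_fsupp.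
have lin a b c u v w a' b' c' u' v' w' :
    fsupp u -> fsupp v -> fsupp w -> fsupp u' -> fsupp v' -> fsupp w' ->
    (forall t, a * u t + b * v t + c * w t = a' * u' t + b' * v' t + c' * w' t) ->
    a * zsum u + b * zsum v + c * zsum w
    = a' * zsum u' + b' * zsum v' + c' * zsum w'.
  by move=> *; rewrite -!zsum_lin3 //; apply: eq_zsum.
have pas k : 0 <= k -> kk k = pw k%:~R * k0 k + k1 k
    /\ kk k = k0 k + pw (x + y + 1) * k1 k.
  move=> hk; have hk' : 0 <= k%:~R :> rat by rewrite ler0z.
  have [|p1 p2] := @qb_pascal (x + y + k%:~R) k; first by lra.
  rewrite /kk /k0 /k1 addr0; split; first exact: p1.
  by rewrite p2; congr (_ + pw _ * _); ring.
have relA k : fa (x + 1) y k - pw (A - k + 1)%:~R * fa x y k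
            = fb x (y + 1) k - pw (B - k + 1)%:~R * fb x y k.
  by rewrite /fa /fb !addr0 fork_relA.
have relB k : pw ((A - k)%:~R - x) * (fa (x + 1) y k - fa x y k)
            = pw ((B - k)%:~R - y) * (fb x (y + 1) k - fb x y k).
  by rewrite /fa /fb !addr0 fork_relB.
have zero k : k < 0 -> [/\ kk k = 0, k0 k = 0 & k1 k = 0].
  by move=> hk; split; rewrite /kk /k0 /k1 ?addr0 qb_lt0 //; lia.
split.
- rewrite -[zsum (fun k => k1 k * fb _ _ k)]mul1r -[zsum (fun k => kk k * fa _ _ k)]mul1r.
  rewrite -[zsum (fun k => k1 k * fa _ _ k)]mul1r -[zsum (fun k => kk k * fb _ _ k)]mul1r.
  rewrite -!mulNr; apply: lin => // k; have [/zero[-> -> ->]|] := ltP k 0; first by ring.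
  move=> /pas[-> _]; have := relA k.
  have -> : pw (A + 1)%:~R = pw k%:~R * pw (A - k + 1)%:~R.
    by rewrite -pwD -rmorphD; congr (pw _%:~R); ring.
  have -> : pw (B + 1)%:~R = pw k%:~R * pw (B - k + 1)%:~R.
    by rewrite -pwD -rmorphD; congr (pw _%:~R); ring.
  set e1 := pw k%:~R; set e2 := pw (A - k + 1)%:~R; set e3 := pw (B - k + 1)%:~R.
  move=> /(congr1 (fun z => e1 * k0 k * z)) h.
  apply/eqP; rewrite -subr_eq0; move/eqP: h; rewrite -subr_eq0.
  by congr (_ == _); ring.
- set u := x + 1 / 2 + _; set v := y + 1 / 2 + _.
  rewrite !mulrBr !addrA -!mulNr; apply: lin => // k.
  have [/zero[-> -> ->]|] := ltP k 0; first by ring.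
  move=> /pas[_ ->]; have := relB k.
  have -> : pw ((A - k)%:~R - x) = pw (1 / 2 + (A%:~R + B%:~R) / 2 - k%:~R) * pw (- u).
    by rewrite -pwD rmorphB /=; congr pw; rewrite /u; field.
  have -> : pw ((B - k)%:~R - y) = pw (1 / 2 + (A%:~R + B%:~R) / 2 - k%:~R) * pw (- v).
    by rewrite -pwD rmorphB /=; congr pw; rewrite /v; field.
  rewrite -!mulrA => /(mulfI (pw_neq0 _)) h.
  have -> : x + y + 1 = u + v by rewrite /u /v; field.
  have e1 : pw (u + v) * pw (- u) = pw v by rewrite -pwD; congr pw; ring.
  have e2 : pw (u + v) * pw (- v) = pw u by rewrite -pwD; congr pw; ring.
  move/(congr1 (fun z => k0 k * z)): h; rewrite -e1 -e2 => h.
  apply/eqP; rewrite -subr_eq0; move/eqP: h; rewrite -subr_eq0.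
  by congr (_ == _); ring.
Qed.

(** * Equality of the two sums *)

(** All differences of consecutive heights have the same parity where the weight
is nonzero, so only one residue class of the last height matters. *)
Lemma chain_parity B e e' n r s : 0 <= r ->
  (forall t j, 0 <= t -> t = r - s + B + 2 * j -> e t = e' t) ->
  chain B e n r s = chain B e' n r s.
Proof.
elim: n r s => [|n IHn] r s r0 he /=.
  by case: (s =P B) => // sB; rewrite (he r 0) // sB; lia.
congr (_ * _); apply: eq_zsum => t.
have [->|/qb_neq0[s0 _ /intrP[j hj]]] := eqVneq (qb (r%:~R / 2 + t%:~R / 2) s) 0.
  by rewrite !mul0r.
congr (_ * _); apply: IHn => // u i u0 hu; apply: (he u (i + s - j)) => //.
have : r + t = 2 * j.
  apply: (@intr_inj rat); rewrite rmorphM rmorphD /= -hj.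
  by rewrite -[2%:~R]/(2 : rat); field.
by lia.
Qed.

Lemma chainZ B e c n r s : chain B (fun t => c * e t) n r s = c * chain B e n r s.
Proof.
elim: n r s => [|n IHn] r s /=; first by case: ifP; rewrite ?mulr0 // mulrCA.
rewrite /transfer (@eq_node_sum _ _ _ (fun t => c * chain B e n s t)) ?node_sumZ //.
by rewrite mulrCA.
Qed.

Lemma qb0_parity x j : 0 <= x -> 0 <= x + j%:~R -> qb (x + j%:~R) 0 = qb x 0.
Proof.
move=> x0 xj; have [hx|hx] := boolP (x \is a Num.int).
  by rewrite !qb0 // rpredD ?intr_int.
have z y : y \isn't a Num.int -> qb y 0 = 0.
  by move=> hy; apply/eqP; apply: contraNT hy => /qb_neq0[].
by rewrite !z // rpredDr ?intr_int.
Qed.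

(** For [B = 0] the q-binomial at the end of the cycle sum only tests the parity
and the sign of its top entry, as does the second q-binomial of the fork; the
two tests are equivalent because of [chain_parity]. *)
Lemma cycle_fork_sum0 n x y A : 0 <= A -> 0 <= x -> 0 <= y ->
  cycle_sum n x A 0 (y + A%:~R / 2) = fork_sum n x y A 0.
Proof.
move=> A0 x0 y0.
have A0' : 0 <= A%:~R :> rat by rewrite ler0z.
rewrite /fork_sum (@zsum_single _ 0); last first.
  move=> k k0; have [k_lt|k_ge] := ltP k 0; first by rewrite qb_lt0 ?mul0r.
  by rewrite fork_lt0 ?mulr0 //; lia.
rewrite /fork /cycle_sum /node_sum -zsumZ; apply: eq_zsum => s.
have e1 : A - 0 = A by rewrite subr0.
have e2 : 0 - 0 = 0 :> int by [].
have e3 : x + y + 0%:~R = x + y by rewrite addr0.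
rewrite e1 e2 e3 addr0 {e1 e2 e3}.
have [s0|s0] := ltP s 0; first by rewrite rchain_lt0 // chain0_lt0 // !mulr0.
have s0' : 0 <= s%:~R :> rat by rewrite ler0z.
have -> : rchain n 0 (y + A%:~R / 2) A s = qb (y + s%:~R / 2) 0 * chain0 n A s.
  rewrite -chainZ; apply: chain_parity => // t j t0 ht; rewrite mulr1.
  have t0' : 0 <= t%:~R :> rat by rewrite ler0z.
  have -> : y + A%:~R / 2 + t%:~R / 2 = y + s%:~R / 2 + (A - s + j)%:~R.
    by rewrite ht !rmorphD rmorphM rmorphN /=; field.
  apply: qb0_parity; first by lra.
  have -> : y + s%:~R / 2 + (A - s + j)%:~R = y + A%:~R / 2 + t%:~R / 2.
    by rewrite ht !rmorphD rmorphM rmorphN /=; field.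
  by lra.
have [->|/qb_neq0[_ _ hx]] := eqVneq (qb (x + s%:~R / 2) A) 0.
  by rewrite !mul0r mulr0.
have [->|/qb_neq0[_ _ hy]] := eqVneq (qb (y + s%:~R / 2) 0) 0.
  by rewrite !(mul0r, mulr0).
rewrite [qb (x + y) 0]qb0 ?mul1r ?addr_ge0 //.
have -> : x + y = x + s%:~R / 2 + (y + s%:~R / 2) - s%:~R by field.
by apply: rpredB; [exact: rpredD|exact: intr_int].
Qed.

Lemma cycle_sum_lt0 n x A B y : B < 0 -> cycle_sum n x A B y = 0.
Proof.
move=> B0; apply: fsbig1 => s _; rewrite (_ : rchain n B y A s = 0) ?mulr0 //.
have -> : rchain n B y A s = chain B (fun=> 0 * 0) n A s.
  by congr chain; apply/funext => t; rewrite qb_lt0 // mul0r.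
by rewrite chainZ mul0r.
Qed.

Lemma fork_sum_lt0 n x y A B : A < 0 \/ B < 0 -> fork_sum n x y A B = 0.
Proof.
move=> AB; apply: fsbig1 => k _.
have [k_lt|k_ge] := ltP k 0; first by rewrite qb_lt0 ?mul0r.
case: AB => h; last by rewrite fork_lt0 ?mulr0 //; lia.
by rewrite forkC fork_lt0 ?mulr0 //; lia.
Qed.

(** The relations at [B] express the value at [B + 1] for [y] and for [y + 1]
through values at [B] and [B - 1].  They are independent, because
[q ^+ B.+1 != 1]. *)
Lemma cycle_fork_sum n x y A B : 0 <= x -> 0 <= y -> 0 <= B ->
  cycle_sum n (x + B%:~R / 2) A B (y + A%:~R / 2) = fork_sum n x y A B.
Proof.
move=> x0 y0; case: B => // B _.
suff [//] : (forall A x y, 0 <= x -> 0 <= y ->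
    cycle_sum n (x + B%:~R / 2) A B (y + A%:~R / 2) = fork_sum n x y A B)
  /\ (forall A x y, 0 <= x -> 0 <= y ->
    cycle_sum n (x + (B%:Z - 1)%:~R / 2) A (B%:Z - 1) (y + A%:~R / 2)
    = fork_sum n x y A (B%:Z - 1)).
  by move=> h _; exact: h.
have neg A' x' y' B' : A' < 0 -> cycle_sum n x' A' B' y' = 0.
  by move=> A0; apply: fsbig1 => s _; rewrite qb_lt0 // mul0r.
elim: B {A x y x0 y0} => [|B [IHB IHB1]]; split=> A x y x0 y0.
- have [A0|A0] := ltP A 0; first by rewrite neg // fork_sum_lt0 //; left.
  by rewrite mul0r addr0 cycle_fork_sum0.
- by rewrite cycle_sum_lt0 // fork_sum_lt0 //; right.
- have [A0|A0] := ltP A 0; first by rewrite neg // fork_sum_lt0 //; left.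
  have A0' : 0 <= A%:~R :> rat by rewrite ler0z.
  have B0' : 0 <= B%:~R :> rat by rewrite ler0z.
  (* The relations are centred at x + 1/2, y + 1/2: then all the inhomogeneities
     in them are among x, x + 1 and y, y + 1. *)
  pose X := x + 1 / 2 + B%:~R / 2; pose Y := y + 1 / 2 + A%:~R / 2.
  have X0 : 0 <= X by rewrite /X; lra.
  have Y0 : 0 <= Y by rewrite /Y; lra.
  have := cycle_sum_relA n B A0 X0 Y0; have := cycle_sum_relB n B A0 X0 Y0.
  have useW A' B' x' y' X' Y' : cycle_sum n (x' + B'%:~R / 2) A' B' (y' + A'%:~R / 2)
      = fork_sum n x' y' A' B' -> X' = x' + B'%:~R / 2 -> Y' = y' + A'%:~R / 2 ->
      cycle_sum n X' A' B' Y' = fork_sum n x' y' A' B'.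
    by move=> h -> ->.
  have x1 : 0 <= x + 1 by rewrite addr_ge0.
  have y1 : 0 <= y + 1 by rewrite addr_ge0.
  have w1 : cycle_sum n (X - 1 / 2) (A - 1) B Y = fork_sum n x (y + 1) (A - 1) B.
    apply: useW (IHB _ _ _ x0 y1) _ _; first by rewrite /X; field.
    by rewrite /Y rmorphB /=; field.
  have w2 : cycle_sum n (X + 1 / 2) (A + 1) B Y = fork_sum n (x + 1) y (A + 1) B.
    apply: useW (IHB _ _ _ x1 y0) _ _; first by rewrite /X; field.
    by rewrite /Y rmorphD /=; field.
  have w3 : cycle_sum n (X - 1 / 2) (A + 1) B Y = fork_sum n x y (A + 1) B.
    apply: useW (IHB _ _ _ x0 y0) _ _; first by rewrite /X; field.
    by rewrite /Y rmorphD /=; field.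
  have w4 : cycle_sum n X A (B%:Z - 1) (Y - 1 / 2) = fork_sum n (x + 1) y A (B%:Z - 1).
    apply: useW (IHB1 _ _ _ x1 y0) _ _; last by rewrite /Y; field.
    by rewrite /X rmorphB /=; field.
  have e6 : Y - 1 / 2 = y + A%:~R / 2 by rewrite /Y; field.
  have e7 : x + B.+1%:~R / 2 = X.
    by rewrite /X -[B.+1%:~R]natr1 -[B%:~R]/(B%:R : rat); field.
  rewrite w1 w2 w3 w4 e6 e7 {w1 w2 w3 w4 e6 e7 useW}.
  have [] := fork_sum_relations n A B x0 y0.
  have -> : X - A%:~R / 2 = x + 1 / 2 + (B%:~R - A%:~R) / 2 by rewrite /X; field.
  have -> : Y - B%:~R / 2 = y + 1 / 2 + (A%:~R - B%:~R) / 2 by rewrite /Y; field.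
  have -> : A%:~R / 2 - X = - (x + 1 / 2 + (B%:~R - A%:~R) / 2) by rewrite /X; field.
  have -> : B%:~R / 2 - Y = - (y + 1 / 2 + (A%:~R - B%:~R) / 2) by rewrite /Y; field.
  have -> : (Posz B + 1) = B.+1 by lia.
  set w5 := cycle_sum n X A B.+1 _; set w6 := cycle_sum n X A B.+1 _.
  set v5 := fork_sum n x (y + 1) A B.+1; set v6 := fork_sum n x y A B.+1.
  move=> -> -> /addrI/(mulfI (pw_neq0 _)) hB; rewrite -!addrA => /addrI hA.
  have /eqP : (1 - q ^+ B.+1) * (w6 - v6) = 0.
    have e5 : w5 = v5 - v6 + w6 by rewrite hB subrK.
    rewrite -pw_nat; move: hA; rewrite e5 -[pw B.+1%:~R]/(pw B.+1%:R).
    by move/esym/eqP; rewrite -subr_eq0 => /eqP <-; ring.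
  rewrite mulf_eq0 subr_eq0 eq_sym (negPf (hq _)) //= subr_eq0.
  by move/eqP.
- have -> : Posz B.+1 - 1 = B by lia.
  exact: IHB.
Qed.

(** * Chains as sums over lists of heights *)

Fixpoint path_weight (B : int) (e : int -> F) (r s : int) (ts : seq int) : F :=
  match ts with
  | [::] => edge r s * qb (r%:~R / 2 + B%:~R / 2) s * (edge s B * e s)
  | t :: ts' => edge r s * qb (r%:~R / 2 + t%:~R / 2) s * path_weight B e s t ts'
  end.

Fixpoint box (n K : nat) : seq (seq int) :=
  if n is n'.+1 then [seq x :: xs | x <- map Posz (iota 0 K), xs <- box n' K]
  else [:: [::]].

Lemma mem_box n K xs :
  (xs \in box n K) = (size xs == n) && all (fun x => 0 <= x < K%:Z) xs.
Proof.
have memP x : (x \in map Posz (iota 0 K)) = (0 <= x < K%:Z).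
  apply/mapP/idP => [[k]|hx]; first by rewrite mem_iota => hk ->; lia.
  by exists (absz x); rewrite ?mem_iota; lia.
elim: n xs => [|n IHn] xs /=; first by case: xs => [|x xs].
apply/allpairsP/idP => [[[x ys] /= [hx hy ->]]|].
  by move: hx hy; rewrite memP IHn /= eqSS => -> .
case: xs => [//|x xs] /=; rewrite eqSS andbCA => /andP[hx hxs].
by exists (x, xs); rewrite memP IHn.
Qed.

Lemma box_uniq n K : uniq (box n K).
Proof.
elim: n => //= n IHn; apply: allpairs_uniq => //.
  by rewrite map_inj_uniq ?iota_uniq // => x y [].
by move=> [x xs] [y ys] _ _ /= [-> ->].
Qed.

Lemma zsum_box u (K : nat) : (forall t, u t != 0 -> 0 <= t < K%:Z) ->
  zsum u = \sum_(t <- map Posz (iota 0 K)) u t.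
Proof.
move=> hu; rewrite /zsum (fsbigE (map Posz (iota 0 K))) //.
- by apply: eq_bigl => t; rewrite in_setT.
- by rewrite map_inj_uniq ?iota_uniq // => x y [].
move=> t _; apply: contraNeq => /hu ht; apply/mapP.
by exists (absz t); rewrite ?mem_iota; lia.
Qed.

Lemma chain_box B e n r s (K : nat) : (0 <= B \/ forall t, e t = 0) ->
  s < K%:Z -> B < K%:Z ->
  chain B e n.+1 r s = \sum_(ts <- box n K) path_weight B e r s ts.
Proof.
move=> hB; elim: n r s => [|n IHn] r s sK BK.
  rewrite /= big_seq1 /= /transfer /node_sum.
  rewrite (@zsum_single _ B) ?eqxx ?mulrA // => t /negPf ->.
  by rewrite mulr0.
rewrite -[LHS]/(transfer (chain B e n.+1) r s) /transfer /node_sum.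
rewrite (@zsum_box _ K); last first.
  move=> t; rewrite mulf_eq0 negb_or => /andP[_ /(chain_supp hB)]; lia.
rewrite [box _ _]/= big_allpairs_dep mulr_sumr; apply: eq_big_seq => t /mapP[k].
rewrite mem_iota => hk ->; rewrite IHn //.
by rewrite !mulr_sumr; apply: eq_bigr => ts _ /=; rewrite !mulrA.
Qed.

Lemma path_weight_bound B e r s ts : (0 <= B \/ forall t, e t = 0) ->
  path_weight B e r s ts != 0 ->
  forall x, x \in s :: ts -> 0 <= x /\ (x <= r \/ x <= B).
Proof.
move=> hB; elim: ts r s => [|t ts IHts] r s /=.
  rewrite !mulf_eq0 !negb_or => /andP[/andP[_ /qb_neq0[s0 st _]] /andP[_ es]] x.
  rewrite inE => /eqP ->; split=> //.
  move: st; rewrite -mulrDl ler_pdivlMr // -rmorphD -[2]/(2%:~R) -rmorphM ler_int.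
  by have [sr|sr] := leP s r; [left|right; lia].
rewrite !mulf_eq0 !negb_or => /andP[/andP[_ /qb_neq0[s0 st _]] /IHts h].
have [t0 ht] := h t (mem_head _ _).
move: st; rewrite -mulrDl ler_pdivlMr // -rmorphD -[2]/(2%:~R) -rmorphM ler_int => st.
have sr : s <= r \/ s <= B.
  by have [sr|sr] := leP s r; [left|right; case: ht; lia].
move=> x; rewrite inE => /predU1P[->//|/h[x0 hx]]; split=> //.
by have [xr|xr] := leP x r; [left|right; lia].
Qed.

(** The sequence of heights [A], [ms], [B], the default value providing [B]. *)
Definition extend (A B : int) (ms : seq int) (j : nat) : int := nth B (A :: ms) j.

Lemma path_weight_extend B e r s ts : path_weight B e r s ts
  = (\prod_(j < (size ts).+2) edge (extend r B (s :: ts) j) (extend r B (s :: ts) j.+1))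
    * (\prod_(j < (size ts).+1)
        qb ((extend r B (s :: ts) j)%:~R / 2 + (extend r B (s :: ts) j.+2)%:~R / 2)
           (extend r B (s :: ts) j.+1))
    * e (last s ts).
Proof.
elim: ts r s => [|t ts IHts] r s.
  by rewrite /= !big_ord_recl !big_ord0 /extend /=; ring.
rewrite [LHS]/= IHts [in RHS]big_ord_recl.
rewrite [X in _ = _ * X * _]big_ord_recl /extend /=.
by ring.
Qed.

(** * The quadratic form and the parity condition in terms of heights *)

(** The linear system for [n], with the end heights [f 0] and [f r.+1]. *)
Definition nodes (r : nat) (f : nat -> int) (n : 'cV[int]_r) : Prop :=
  forall j : 'I_r,
    (n j 0)%:~R = (f j)%:~R / 2 + (f j.+2)%:~R / 2 - (f j.+1)%:~R :> rat.

Lemma mn_system_nodes r (f : nat -> int) (n : 'cV[int]_r) :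
  mn_system (f 0 *: unitv r 1 + f r.+1 *: unitv r r) n (\col_(j < r) f j.+1)
  <-> nodes f n.
Proof.
rewrite mn_systemC.
have cE (i : 'I_r) : (cartanA r *m ratv (\col_(j < r) f j.+1)) i 0 =
    2 * (f i.+1)%:~R - (f i)%:~R - (f i.+2)%:~R
    + (i == 0 :> nat)%:R * (f 0)%:~R + (i.+1 == r)%:R * (f r.+1)%:~R.
  rewrite mxE -(cartanA_sum i (fun k => (f k)%:~R)).
  by apply: eq_bigr => k _; rewrite !mxE.
have dE (i : 'I_r) : (ratv (f 0 *: unitv r 1 + f r.+1 *: unitv r r) - 2 *: ratv n) i 0
    = (f 0)%:~R * (i == 0 :> nat)%:R + (f r.+1)%:~R * (i.+1 == r)%:R
      - 2 * (n i 0)%:~R.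
  have e (c : bool) : (c%:R : int)%:~R = c%:R :> rat by case: c.
  by rewrite !mxE rmorphD !rmorphM /= !e eqSS.
split=> [/matrixP h j|h].
  move: (h j 0); rewrite cE dE; lra.
by apply/matrixP => i j; rewrite (ord1 j) cE dE h; field.
Qed.

Lemma succ_neq0 (r : nat) : r%:R + 1 != 0 :> rat /\ 1 + r%:R != 0 :> rat.
Proof. by rewrite addrC nat1r pnatr_eq0. Qed.

(** Half the deviation of the heights from the linear interpolation of the end
heights.  It vanishes at both ends and the interpolation has no second
difference, so [C] maps these values to [n]. *)
Definition deviation (f : nat -> int) (r j : nat) : rat :=
  ((f 0)%:~R + ((f r.+1)%:~R - (f 0)%:~R) * j%:R / r.+1%:R - (f j)%:~R) / 2.

Lemma invmx_nodes r (f : nat -> int) (n : 'cV[int]_r) : nodes f n ->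
  invmx (cartanA r) *m ratv n = \col_j deviation f r j.+1.
Proof.
move=> h; have [r0 r1] := succ_neq0 r.
have h0 : deviation f r 0 = 0 by rewrite /deviation mulr0 mul0r addr0 subrr mul0r.
have hr : deviation f r r.+1 = 0 by rewrite /deviation; field; rewrite ?r0 ?r1.
suff <- : cartanA r *m (\col_j deviation f r j.+1) = ratv n.
  by rewrite mulKmx ?cartanA_unit.
apply/matrixP => i j; rewrite (ord1 j) mxE.
under eq_bigr => k _ do rewrite [(\col_j _) k 0]mxE.
rewrite cartanA_sum h0 hr !mulr0 !addr0 mxE h /deviation -!natr1.
by field; rewrite ?r0 ?r1.
Qed.

Lemma sum_by_parts (g : nat -> rat) r : g 0 = 0 -> g r.+1 = 0 ->
  \sum_(j < r) (2 * g j.+1 - g j - g j.+2) * g j.+1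
  = \sum_(j < r.+1) (g j - g j.+1) ^+ 2.
Proof.
move=> g0 gr.
suff -> : \sum_(j < r) (2 * g j.+1 - g j - g j.+2) * g j.+1
    = \sum_(j < r) (g j - g j.+1) ^+ 2 + (g r ^+ 2 - g r * g r.+1).
  by rewrite big_ord_recr /= gr; ring.
elim: r {gr} => [|r IHr]; first by rewrite !big_ord0 g0; ring.
by rewrite big_ord_recr /= IHr [in RHS]big_ord_recr /=; ring.
Qed.

(** Summation by parts turns [n C^-1 n] into a sum of squared differences of the
deviation; the cross term with the slope of the interpolation telescopes. *)
Lemma qformA_nodes r (f : nat -> int) (n : 'cV[int]_r) : nodes f n ->
  qformA n = (\sum_(j < r.+1) ((f j)%:~R - (f j.+1)%:~R) ^+ 2) / 4
             - (f 0 - f r.+1)%:~R ^+ 2 / (4 * r.+1%:R).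
Proof.
move=> h; have [r0 r1] := succ_neq0 r.
rewrite /qformA -mulmxA (invmx_nodes h) mxE.
have h0 : deviation f r 0 = 0 by rewrite /deviation mulr0 mul0r addr0 subrr mul0r.
have hr : deviation f r r.+1 = 0 by rewrite /deviation; field; rewrite ?r0 ?r1.
rewrite (eq_bigr (fun j : 'I_r => (2 * deviation f r j.+1 - deviation f r j
    - deviation f r j.+2) * deviation f r j.+1)); last first.
  move=> j _; rewrite !mxE h; congr (_ * _); rewrite /deviation -!natr1; field.
  by rewrite ?r0 ?r1.
rewrite (sum_by_parts h0 hr).
pose c : rat := (f 0 - f r.+1)%:~R / r.+1%:R.
rewrite (eq_bigr (fun j : 'I_r.+1 => (((f j)%:~R - (f j.+1)%:~R) ^+ 2 / 4
    + c / 2 * ((f j.+1)%:~R - (f j)%:~R)) + c ^+ 2 / 4)); last first.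
  by move=> j _; rewrite /deviation /c rmorphB /= -!natr1; field; rewrite ?r0 ?r1.
rewrite !big_split /= sumr_const card_ord -mulr_suml -mulr_sumr.
rewrite -(big_mkord xpredT (fun j => (f j.+1)%:~R - (f j)%:~R)).
rewrite telescope_sumr // -mulr_natr /c rmorphB /=; field; rewrite ?r0 ?r1 //.
Qed.

Lemma parity_nodes r (f : nat -> int) (n : 'cV[int]_r) (sigma : int) :
  nodes f n ->
  parity_cond (N := r.+1) sigma (f 0 - f r.+1) n
  <-> exists j : int, sigma + f 0 - f 1 = 2 * j.
Proof.
move=> h; rewrite /parity_cond (invmx_nodes h).
have [r0 r1] := succ_neq0 r.
set y := entry _ _ _.
have -> : (f 0 - f r.+1 + sigma * r.+1)%:~R / (2 * r.+1%:R) + y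
  = (sigma + f 0 - f 1)%:~R / 2.
  have -> : y = deviation f r 1.
    rewrite /y /entry; case: pickP => [j /eqP [j0]|noj]; first by rewrite mxE j0.
    case: r {h y r0 r1} n noj => [|r] n noj; last by have := noj ord0; rewrite eqxx.
    by rewrite /deviation; field.
  rewrite /deviation !(rmorphD, rmorphN, rmorphM) /=.
  have -> : (r.+1 : int)%:~R = r.+1%:R :> rat by [].
  by field; rewrite ?r0 ?r1.
split=> [/intrP[j hj]|[j ->]].
  exists j; apply: (@intr_inj rat); rewrite intrM -hj /=.
  by rewrite -[2%:~R]/(2 : rat); field.
by rewrite rmorphM /= -[2%:~R]/(2 : rat) mulrC mulKf ?intr_int.
Qed.

(** * From vectors to chains *)

Definition chain_weight (e : int -> F) (r : nat) (f : nat -> int) : F :=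
  (\prod_(j < r.+1) edge (f j) (f j.+1))
  * (\prod_(j < r) qb ((f j)%:~R / 2 + (f j.+2)%:~R / 2) (f j.+1))
  * e (f r).

Lemma path_weight_prod B e A s ts :
  path_weight B e A s ts = chain_weight e (size ts).+1 (extend A B (s :: ts)).
Proof. by rewrite path_weight_extend -[last s ts]/(last B (s :: ts)) -nth_last. Qed.

Lemma zsum_chain_box (E : int -> F) A B e r (K : nat) :
  (0 <= B \/ forall t, e t = 0) -> A < K%:Z -> B < K%:Z ->
  zsum (fun s => E s * chain B e r A s)
  = \sum_(ms <- box r K) E (extend A B ms 1) * chain_weight e r (extend A B ms).
Proof.
move=> hB AK BK; case: r => [|r].
  rewrite (@zsum_single _ B) => [|t /= /negPf ->]; last by rewrite mulr0.
  by rewrite big_seq1 /= eqxx /chain_weight big_ord1 big_ord0 mulr1.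
rewrite (@zsum_box _ K); last first.
  move=> t; rewrite mulf_eq0 negb_or => /andP[_ /(chain_supp hB)]; lia.
rewrite [box _ _]/= big_allpairs_dep; apply: eq_big_seq => t /mapP[k].
rewrite mem_iota => hk ->; rewrite (@chain_box _ _ _ _ _ K) //.
rewrite mulr_sumr; apply: eq_big_seq => ts; rewrite mem_box => /andP[/eqP sz _].
by rewrite path_weight_prod sz.
Qed.

Definition entries (r : nat) (m : 'cV[int]_r) : seq int := [seq m j 0 | j <- enum 'I_r].

Lemma size_entries r (m : 'cV[int]_r) : size (entries m) = r.
Proof. by rewrite size_map size_enum_ord. Qed.

Lemma extend_entries A B r (m : 'cV[int]_r) (j : 'I_r) :
  extend A B (entries m) j.+1 = m j 0.
Proof.
by rewrite /extend /= (nth_map j) ?size_enum_ord // nth_ord_enum.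
Qed.

Lemma extend_entries_end A B r (m : 'cV[int]_r) : extend A B (entries m) r.+1 = B.
Proof. by rewrite /extend nth_default //= size_entries. Qed.

Lemma col_entries A B r (m : 'cV[int]_r) : \col_(j < r) extend A B (entries m) j.+1 = m.
Proof. by apply/matrixP => i j; rewrite (ord1 j) mxE extend_entries. Qed.

Lemma entry_first A B r (m : 'cV[int]_r) : entry B m 1 = extend A B (entries m) 1.
Proof.
rewrite /entry; case: pickP => [j /eqP[j0]|noj].
  by rewrite -(extend_entries A B) j0.
case: r m noj => [|r] m noj; last by have := noj ord0; rewrite eqxx.
by rewrite extend_entries_end.
Qed.

Lemma entry_last A B r (m : 'cV[int]_r) : entry A m r = extend A B (entries m) r.
Proof.
rewrite /entry; case: pickP => [j /eqP jr|noj].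
  by rewrite -(extend_entries A B) jr.
case: r m noj => [|r] m noj; last by have := noj ord_max; rewrite eqxx.
by [].
Qed.

Lemma nodes_uniq r f (n n' : 'cV[int]_r) : nodes f n -> nodes f n' -> n = n'.
Proof.
move=> h h'; apply/matrixP => i j; rewrite (ord1 j).
by apply: (@intr_inj rat); rewrite h h'.
Qed.

(** The top entry at the node [j] is [m_j + n_j], and replacing the bottom entry
[n_j] by [m_j] leaves the q-binomial unchanged. *)
Lemma chain_weight_nodes r f (n m : 'cV[int]_r) (e : int -> F) :
  m = \col_(j < r) f j.+1 -> nodes f n ->
  pw (qformA n) * qbinv q (m + n) n * e (f r)
  = pw (- ((f 0 - f r.+1)%:~R ^+ 2 / (4 * r.+1%:R))) * chain_weight e r f.
Proof.
move=> mE h; rewrite (qformA_nodes h) pwD mulr_suml.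
rewrite (pw_sum r.+1 (fun j => ((f j)%:~R - (f j.+1)%:~R) ^+ 2 / 4)) /chain_weight.
rewrite [pw (- _) * _]mulrA [in RHS]mulrA; congr (_ * _); rewrite -mulrA mulrCA -mulrA.
congr (_ * _).
  congr (_ * _); apply: eq_bigr => j _.
  have -> : (f j)%:~R / 2 + (f j.+2)%:~R / 2 = ((m + n) j 0)%:~R :> rat.
    by rewrite mE !mxE rmorphD /= h; ring.
  rewrite /qb qbin_sym; congr qbin; rewrite mE !mxE rmorphD /=; ring.
Qed.

(** The sum over the vectors [n] of the parity class becomes a sum over all integer
vectors [m]: a nonzero weight forces the tops [(m_(j-1) + m_(j+1)) / 2] to be
integers, which gives back an integer vector [n], and the factor [E] forces the
parity.  The support is a box of side exceeding the end heights, by convexity,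
and over this box the sum is the iterated one. *)
Lemma vector_sum r (sigma A B : int) (E e : int -> F) :
  (0 <= B \/ forall t, e t = 0) ->
  (forall s, E s != 0 -> exists j : int, sigma + A - s = 2 * j) ->
  \sum_(n \in [set n : 'cV[int]_r | parity_cond (N := r.+1) sigma (A - B) n])
    (let m := mn_solve (A *: unitv r 1 + B *: unitv r r) n in
     pw (qformA n) * qbinv q (m + n) n * (E (entry B m 1) * e (entry A m r)))
  = pw (- ((A - B)%:~R ^+ 2 / (4 * r.+1%:R)))
    * zsum (fun s => E s * chain B e r A s).
Proof.
move=> hB hE; set P := [set n | _]; set h := mn_solve _ => /=.
pose c := (A - B)%:~R ^+ 2 / (4 * r.+1%:R) : rat.
pose f m := extend A B (@entries r m).
pose T m := pw (- c) * (E (f m 1) * chain_weight e r (f m)).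
have sysE n m : mn_system (A *: unitv r 1 + B *: unitv r r) n m <-> nodes (f m) n.
  rewrite -(mn_system_nodes (f m)) /f col_entries extend_entries_end //.
have hP n : P n -> nodes (f (h n)) n.
  by move=> Pn; apply/sysE/mn_solveP; apply: (@mn_solution r.+1 sigma).
have termE n : P n ->
    pw (qformA n) * qbinv q (h n + n) n * (E (entry B (h n) 1) * e (entry A (h n) r))
    = T (h n).
  move=> /hP hn; rewrite (entry_first A) (entry_last _ B) -/(f _).
  rewrite mulrCA (@chain_weight_nodes _ (f (h n))) //; last by rewrite /f col_entries.
  by rewrite /T mulrCA /f extend_entries_end.
rewrite (eq_fsbigr (fun n => T (h n))); last by move=> n /set_mem /termE.
have inj : {in P &, injective h}.
  move=> n n' /set_mem /hP hn /set_mem /hP hn' hh.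
  by apply: nodes_uniq hn _; rewrite hh.
rewrite -(fsbig_image P h T inj) (fsbig_widen _ setT) //; last first.
  move=> m [_ /= hm]; apply/eqP; apply: contra_notT hm.
  rewrite /T /chain_weight !mulf_eq0 !negb_or => /andP[_ /andP[Em /andP[/andP[_ hq1] _]]].
  have int_top (j : 'I_r) :
      (f m j)%:~R / 2 + (f m j.+2)%:~R / 2 \is a @Num.int rat.
    move/prodf_neq0: hq1 => /(_ j isT) /qb_neq0[_ _ //].
  pose n : 'cV[int]_r := \col_j (Num.floor ((f m j)%:~R / 2 + (f m j.+2)%:~R / 2 : rat)
                        - f m j.+1).
  have hn : nodes (f m) n.
    by move=> j; rewrite mxE rmorphB /= floorK.
  have Pn : P n.
    have := parity_nodes sigma hn; rewrite /f extend_entries_end => hp.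
    by apply/hp; exact: hE.
  exists n => //; apply: (mn_system_uniq (b := A *: unitv r 1 + B *: unitv r r) (n := n)).
    by apply/sysE; exact: hP.
  exact/sysE.
pose K := (`|A| + `|B| + 1)%N.
rewrite (@zsum_chain_box _ _ _ _ _ K) //; try by rewrite /K; lia.
pose vec (ms : seq int) : 'cV[int]_r := \col_j nth 0 ms j.
have lstK ms : ms \in box r K -> entries (vec ms) = ms.
  rewrite mem_box => /andP[/eqP sz _]; apply: (@eq_from_nth _ 0).
    by rewrite size_entries sz.
  move=> i; rewrite size_entries => ir; have := extend_entries 0 0 (vec ms) (Ordinal ir).
  by rewrite /extend /= => ->; rewrite mxE.
have vecK m : vec (entries m) = m.
  by apply/matrixP => i j; rewrite (ord1 j) mxE -[RHS](extend_entries 0 0).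
rewrite (fsbigE [seq vec ms | ms <- box r K]) //; last 2 first.
- rewrite map_inj_in_uniq ?box_uniq // => x y hx hy xy.
  by rewrite -(lstK x) // -(lstK y) // xy.
- move=> m _; apply: contraNeq => Tm; apply/mapP.
  exists (entries m); last by rewrite vecK.
  rewrite mem_box size_entries eqxx /=.
  move: Tm; rewrite /T mulf_eq0 negb_or => /andP[_].
  rewrite mulf_eq0 negb_or => /andP[_].
  rewrite /f; have := size_entries m; case: (entries m) => [|s ts] // sz.
  have -> : r = (size ts).+1 by rewrite -sz.
  rewrite -path_weight_prod => /(path_weight_bound hB) hx; apply/allP => x /hx.
  by rewrite /K; lia.
rewrite big_map mulr_sumr big_seq_cond [RHS]big_seq.
apply: eq_big => [ms|ms /andP[hms _]]; first by rewrite in_setT andbT.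
by rewrite /T /f lstK.
Qed.

(** * The identity *)

Lemma half_parity (x : rat) (u v : int) :
  x + u%:~R / 2 \is a Num.int -> x + v%:~R / 2 \is a Num.int ->
  exists j : int, u - v = 2 * j.
Proof.
move=> hu hv; have /intrP[j hj] : (u - v)%:~R / 2 \is a @Num.int rat.
  have -> : (u - v)%:~R / 2 = (x + u%:~R / 2) - (x + v%:~R / 2).
    by rewrite rmorphB /=; field.
  exact: rpredB.
exists j; apply: (@intr_inj rat); rewrite intrM -hj.
by rewrite -[2%:~R]/(2 : rat); field.
Qed.

Lemma rhs_cycle_sum r (sigma l M : int) (L1 L2 : rat) :
  L1 + (l + sigma)%:~R / 2 \is a Num.int ->
  \sum_(eta \in [set eta : 'cV[int]_r | parity_cond (N := r.+1) sigma l eta])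
      (let mu := muvec l M eta in
       let mu1 := (entry M mu 1)%:~R in
       let muN1 := (entry (M + l) mu r)%:~R in
       pw (qformA eta) * qbinv q (mu + eta) eta
       * qbin q (L1 + (M%:~R + mu1) / 2) (M + l)%:~R
       * qbin q (L2 + ((M + l)%:~R + muN1) / 2) M%:~R)
  = pw (- (l%:~R ^+ 2 / (4 * r.+1%:R)))
    * cycle_sum r (L1 + M%:~R / 2) (M + l) M (L2 + (M + l)%:~R / 2).
Proof.
move=> hL1.
pose E s := qb (L1 + M%:~R / 2 + s%:~R / 2) (M + l).
pose e t := qb (L2 + (M + l)%:~R / 2 + t%:~R / 2) M.
have hB : 0 <= M \/ forall t, e t = 0.
  by have [M0|M0] := ltP M 0; [right=> t; rewrite /e qb_lt0|left].
have hE s : E s != 0 -> exists j : int, sigma + (M + l) - s = 2 * j.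
  move=> /qb_neq0[_ _ h]; have [//||j hj] := @half_parity L1 (l + sigma) (M + s).
    by rewrite rmorphD mulrDl addrA.
  by exists (j + M); lia.
have lE : M + l - M = l by lia.
have := @vector_sum r sigma (M + l) M E e hB hE; rewrite lE => <-.
apply: eq_fsbigr => n _ /=; rewrite -[mn_solve _ n]/(muvec l M n) -[LHS]mulrA.
by rewrite /E /e /qb !mulrDl !addrA.
Qed.

Lemma lhs_fork r (sigma l i : int) (L1 L2 : rat) :
  L1 + (l + sigma)%:~R / 2 \is a Num.int ->
  pw ((i * (i + l))%:~R / r.+1%:R)
  * \sum_(n \in [set n : 'cV[int]_r | parity_cond (N := r.+1) sigma (2 * i + l) n])
      (let m := mvec l i n in
       let m1 := (entry 0 m 1)%:~R in
       pw (qformA n) * qbinv q (m + n) n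
       * qbin q (L1 + m1 / 2) (i + l)%:~R
       * qbin q (L2 + m1 / 2) i%:~R)
  = pw (- (l%:~R ^+ 2 / (4 * r.+1%:R))) * fork r L1 L2 (i + l) i.
Proof.
move=> hL1.
pose E s := qb (L1 + s%:~R / 2) (i + l) * qb (L2 + s%:~R / 2) i.
have hE s : E s != 0 -> exists j : int, sigma + (2 * i + l) - s = 2 * j.
  rewrite mulf_eq0 negb_or => /andP[/qb_neq0[_ _ h] _].
  have [//||j hj] := @half_parity L1 (l + sigma) s; first exact: h.
  by exists (j + i); lia.
have := @vector_sum r sigma (2 * i + l) 0 E (fun=> 1) (or_introl (lexx 0)) hE.
rewrite subr0 scale0r addr0 => sumE.
rewrite (eq_fsbigr (fun n => let m := mvec l i n in
  pw (qformA n) * qbinv q (m + n) n * (E (entry 0 m 1) * 1))); last first.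
  by move=> n _ /=; rewrite mulr1 -mulrA.
rewrite [X in _ * X]sumE mulrA -pwD; congr (pw _ * _).
  have r0 : r.+1%:R != 0 :> rat by rewrite pnatr_eq0.
  have [r1 r2] := succ_neq0 r.
  by rewrite !rmorphM !rmorphD rmorphM /= -natr1; field; rewrite ?r1 ?r2.
apply: eq_zsum => s; rewrite /E /chain0 -mulrA.
by have -> : i + l + i = 2 * i + l by ring.
Qed.

Lemma fork_sum_interval n x y A M :
  fork_sum n x y (M + A) M = \sum_(i \in [set i : int | 0 <= i <= M])
     qb (x + y + (M - i)%:~R) (M - i) * fork n x y (i + A) i.
Proof.
rewrite (fsbig_widen _ setT) //; last first.
  move=> i [_ /= hi]; have [i0|i0] := ltP i 0; first by rewrite fork_lt0 ?mulr0.
  by rewrite qb_lt0 ?mul0r //; lia.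
rewrite /fork_sum /zsum (@reindex_fsbigT _ _ _ _ _ (fun i => M - i)); last first.
  by exists (fun i => M - i) => i; lia.
apply: eq_fsbigr => i _.
by congr (_ * fork _ _ _ _ _); lia.
Qed.

Lemma generalized_saalschutz r (sigma l M : int) (L1 L2 : rat) :
  L1 + (l + sigma)%:~R / 2 \is a Num.int -> 0 <= L1 -> 0 <= L2 ->
  \sum_(i \in [set i : int | 0 <= i <= M])
     (pw ((i * (i + l))%:~R / r.+1%:R)
      * qbin q (L1 + L2 + (M - i)%:~R) (M - i)%:~R
      * \sum_(n \in [set n : 'cV[int]_r | parity_cond (N := r.+1) sigma (2 * i + l) n])
          (let m := mvec l i n in
           let m1 := (entry 0 m 1)%:~R in
           pw (qformA n) * qbinv q (m + n) n
           * qbin q (L1 + m1 / 2) (i + l)%:~R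
           * qbin q (L2 + m1 / 2) i%:~R))
  = \sum_(eta \in [set eta : 'cV[int]_r | parity_cond (N := r.+1) sigma l eta])
      (let mu := muvec l M eta in
       let mu1 := (entry M mu 1)%:~R in
       let muN1 := (entry (M + l) mu r)%:~R in
       pw (qformA eta) * qbinv q (mu + eta) eta
       * qbin q (L1 + (M%:~R + mu1) / 2) (M + l)%:~R
       * qbin q (L2 + ((M + l)%:~R + muN1) / 2) M%:~R).
Proof.
move=> hL1 L1_ge0 L2_ge0; rewrite rhs_cycle_sum //.
have -> : cycle_sum r (L1 + M%:~R / 2) (M + l) M (L2 + (M + l)%:~R / 2)
    = fork_sum r L1 L2 (M + l) M.
  have [M0|M0] := ltP M 0; last exact: cycle_fork_sum.
  by rewrite cycle_sum_lt0 // fork_sum_lt0 //; right.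
rewrite fork_sum_interval mulr_fsumr; apply: eq_fsbigr => i _.
by rewrite mulrAC lhs_fork // -mulrA [fork _ _ _ _ _ * _]mulrC.
Qed.

End GeneralizedSaalschutz.

Theorem theorem2p1 (F : fieldType) (q : F) (qpow : rat -> F)
    (N : nat) (sigma l M : int) (L1 L2 : rat)
    (hqpow : rat_powers q qpow)
    (hq : forall k : nat, (0 < k)%N -> q ^+ k != 1)
    (hsigma : sigma = 0 \/ sigma = 1)
    (hL1 : L1 + (l + sigma)%:~R / 2 \is a Num.int)
    (hL2 : L2 + (l + sigma)%:~R / 2 \is a Num.int)
    (heven : (2 %| l + sigma * N%:Z)%Z)
    (hN : (1 <= N)%N) (hL1_ge0 : 0 <= L1) (hL2_ge0 : 0 <= L2) :
  \sum_(i \in [set i : int | 0 <= i <= M])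
     (qpow ((i * (i + l))%:~R / N%:R)
      * qbin q (L1 + L2 + (M - i)%:~R) (M - i)%:~R
      * \sum_(n \in [set n : 'cV[int]_N.-1 | parity_cond sigma (2 * i + l) n])
          (let m := mvec l i n in
           let m1 := (entry 0 m 1)%:~R in
           qpow (qformA n) * qbinv q (m + n) n
           * qbin q (L1 + m1 / 2) (i + l)%:~R
           * qbin q (L2 + m1 / 2) i%:~R))
  = \sum_(eta \in [set eta : 'cV[int]_N.-1 | parity_cond sigma l eta])
      (let mu := muvec l M eta in
       let mu1 := (entry M mu 1)%:~R in
       let muN1 := (entry (M + l) mu N.-1)%:~R in
       qpow (qformA eta) * qbinv q (mu + eta) eta
       * qbin q (L1 + (M%:~R + mu1) / 2) (M + l)%:~R
       * qbin q (L2 + ((M + l)%:~R + muN1) / 2) M%:~R).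
Proof.
by case: N hN heven => // r _ _; exact: generalized_saalschutz.
Qed.
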